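(* Let $\mathcal{C}$ be the circle in $\mathbb{C}_p$ with center $a$ and radius $R$. Let $\mathcal{D} = D^{+}(a,R)\setminus\bigcup_{i = 1}^{M}D^{-}(x_{i},\rho_{i})$, with $\rho_{i} = R$ for $i=1,\dots,m$ and $\rho_{i} < R$ for $m <i \leq M$. Suppose that $|a - x_{i}|_{p} = R$ for $i \leq m$ and that the discs $D^{-}(x_{i},\rho_{i})$ are mutually disjoint. Let $b$ be a point on $\mathcal{C}$ with $|b - x_{i}|_{p} = R$ for all $i$. Let the $\mathcal{C}_{i}$ be circles having centers $x_{i}$ and radii $r_{i}$ with $\rho_{i} \leq r_{i} \leq R$. Suppose the discs $D^{+}(x_{i},r_{i})$ are mutually disjoint for $i>m$. For each $i$, let $b_{i}$ be a point on $\mathcal{C}_{i}$ with the conditions, for $1 \leq i \leq m$, that $|b_{i} - x_{j}|_{p} = R$ for any $j$ and $|b_{i} - b_{j}|_{p} = R$ if $i \neq j$. Let $\alpha \in \mathbb{Z}_{\geq 0}$. Then there are constants $\mu_{1}, \dotsc, \mu_{M}$, depending only on $\alpha$, the region $\mathcal{D}$ with its choice of boundary circle $\mathcal{C}$, and the arcs $\mathcal{A}(a,b)$ and $\mathcal{A}(x_{i},b_{i})$, such that for any function $f$ that is Krasner analytic on $\mathcal{D}$, $$\int_{\mathcal{A}(a,b),\Phi_{\alpha}}f(x)\,dx = \sum_{i = 1}^{M}\mu_{i} \int_{\mathcal{A}(x_{i},b_{i}),\Phi_{\alpha}}f(x)\,dx .$$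
   Context: $p$ is an odd prime; $\mathbb{C}_p$ is the completion of an algebraic closure of $\mathbb{Q}_p$, with $|p|_p=1/p$. $D^+(c,r)$ and $D^-(c,r)$ are the closed and open discs with center $c$ and radius $r$. Arc: for $a\ne b$ in $\mathbb{C}_p$ with $R=|a-b|_p$, the arc $\mathcal{A}(a,b)$ is the open disc $\{x : |x-b|_p<R\}$. Path sequence: a function $\varphi$ defined for all integers $k\ge k_0$ (some $k_0\in\mathbb{Z}^+$), with values in $\mathbb{Z}^+$ and strictly increasing. For $f:\mathcal{A}(a,b)\to\mathbb{C}_p$ put $A_{f,\varphi}(k)=p^{-\varphi(k)}\sum_{\zeta}(x-a)f(x)$, where $x=a+(b-a)\zeta$ and $\zeta$ runs through the $p^{\varphi(k)}$-th roots of unity. A non-empty family $\Phi$ of path sequences is interlocked if for all $\varphi_1,\varphi_2\in\Phi$ there are $\varphi_3\in\Phi$ and $k_0$ such that $\varphi_3(k)$, $k\ge k_0$, is a subsequence of both $\varphi_1$ and $\varphi_2$. For interlocked $\Phi$, $\int_{\mathcal{A}(a,b),\Phi}f(x)\,dx=L$ means: for every $\varepsilon>0$ there are $\varphi_\varepsilon\in\Phi$ and $K_\varepsilon$ with $|A_{f,\varphi_\varepsilon}(k)-L|_p<\varepsilon$ for all $k>K_\varepsilon$ (such $L$ is unique if it exists). For $\alpha\in\mathbb{Z}$, $\Phi_\alpha$ is the interlocked family $\{\varphi : \varphi(k)=\alpha+\lambda k,\ \lambda=1,2,\dots\}$. A function on $\mathcal{D}$ (a closed disc with finitely many open discs removed)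 is Krasner analytic if it is the uniform limit on $\mathcal{D}$ of rational functions whose poles are outside $\mathcal{D}$.
   Formalization: Each arc A(x_i,b_i) is also assumed to lie in D (automatic unless i>m and r_i=R, where b_i could lie in a removed disc and f is undefined on the arc); the constants depend on each arc A(x_i,b_i) together with its circle C_i, since the bare disc does not determine the integral. *)

(* Defs.v *)
From HB Require Import structures.
From mathcomp Require Import all_boot all_order all_algebra.
From mathcomp Require Import boolp classical_sets functions cardinality fsbigop reals.
From mathcomp Require Import zify.

Set Implicit Arguments.
Unset Strict Implicit.
Unset Printing Implicit Defensive.

Import Order.TTheory GRing.Theory Num.Theory.

Local Open Scope classical_set_scope.
Local Open Scope ring_scope.

Record is_ultrametric_abs (R : realType) (F : fieldType) (v : F -> R) : Prop :=
  IsUltrametricAbs {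
    abs_ge0 : forall x, 0 <= v x;
    abs_eq0 : forall x, v x = 0 <-> x = 0;
    absM : forall x y, v (x * y) = v x * v y;
    abs_ultra : forall x y, v (x + y) <= Num.max (v x) (v y) }.

Definition abs_complete (R : realType) (F : fieldType) (v : F -> R) : Prop :=
  forall u : nat -> F,
    (forall eps : R, 0 < eps ->
       exists N, forall j k, (N <= j)%N -> (N <= k)%N -> v (u j - u k) < eps) ->
    exists l, forall eps : R, 0 < eps ->
      exists N, forall k, (N <= k)%N -> v (u k - l) < eps.

Record is_completion (R : realType) (F K : fieldType) (v : F -> R) (w : K -> R)
    (i : {rmorphism F -> K}) : Prop := IsCompletion {
  completion_abs : is_ultrametric_abs w;
  completion_isometry : forall x, w (i x) = v x;
  completion_dense : forall (y : K) (eps : R), 0 < eps -> exists x, w (y - i x) < eps;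
  completion_complete : abs_complete w }.

(* Normalized so that |p| = 1/p. *)
Definition padic_abs (R : realType) (p : nat) (q : rat) : R :=
  if q == 0 then 0
  else p%:R ^+ logn p `|denq q|%N / p%:R ^+ logn p `|numq q|%N.

(* A model of C_p: the completion of an algebraic closure of the completion of
   the rationals for the p-adic absolute value. It is unique up to isometric
   isomorphism; that the carrier is itself algebraically closed is a theorem,
   not part of the definition. *)
Record Cp_model (p : nat) (R : realType) := CpModel {
  Qp : fieldType;
  Qp_abs : Qp -> R;
  Qp_of_rat : {rmorphism rat -> Qp};
  Qp_completion : is_completion (@padic_abs R p) Qp_abs Qp_of_rat;
  Qpbar : closedFieldType;
  Qpbar_abs : Qpbar -> R;
  Qpbar_of_Qp : {rmorphism Qp -> Qpbar};
  Qpbar_algebraic : forall x : Qpbar, algebraicOver Qpbar_of_Qp x;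
  Qpbar_abs_axiom : is_ultrametric_abs Qpbar_abs;
  Qpbar_abs_extends : forall x : Qp, Qpbar_abs (Qpbar_of_Qp x) = Qp_abs x;
  Cp_field :> fieldType;
  Cp_abs : Cp_field -> R;
  Cp_of_Qpbar : {rmorphism Qpbar -> Cp_field};
  Cp_completion : is_completion Qpbar_abs Cp_abs Cp_of_Qpbar }.

Section Discs.
Variables (p : nat) (R : realType) (C : Cp_model p R).
Implicit Types (a b c : C) (r : R) (D : set C) (f : C -> C).

Definition closed_disc c r : set C := [set x | Cp_abs (x - c) <= r].
Definition open_disc c r : set C := [set x | Cp_abs (x - c) < r].
Definition circle c r : set C := [set x | Cp_abs (x - c) = r].

Definition disc_arc a b : set C := open_disc b (Cp_abs (a - b)).

(* P / Q is in lowest terms, so its poles are exactly the roots of Q. *)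
Definition rational_without_poles_on D (g : C -> C) : Prop :=
  exists P Q : {poly C},
    [/\ Q != 0, coprimep P Q, forall x, root Q x -> ~ D x
      & forall x, D x -> g x = P.[x] / Q.[x]].

Definition uniform_limit_on D (g : nat -> C -> C) f : Prop :=
  forall eps : R, 0 < eps ->
    exists N, forall n, (N <= n)%N -> forall x, D x -> Cp_abs (g n x - f x) < eps.

Definition krasner_analytic D f : Prop :=
  exists g : nat -> C -> C,
    (forall n, rational_without_poles_on D (g n)) /\ uniform_limit_on D g f.

End Discs.

(* The values of ps_fun below ps_start are irrelevant. *)
Record path_seq := PathSeq {
  ps_start : nat;
  ps_fun :> nat -> nat;
  ps_start_gt0 : (0 < ps_start)%N;
  ps_gt0 : forall k, (ps_start <= k)%N -> (0 < ps_fun k)%N;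
  ps_increasing : forall j k, (ps_start <= j)%N -> (j < k)%N -> (ps_fun j < ps_fun k)%N }.

Definition tail_subsequence (k0 : nat) (psi phi : path_seq) : Prop :=
  exists s : nat -> nat,
    [/\ forall k, (k0 <= k)%N -> (ps_start phi <= s k)%N,
        forall j k, (k0 <= j)%N -> (j < k)%N -> (s j < s k)%N
      & forall k, (k0 <= k)%N -> psi k = phi (s k)].

Record interlocked_family := InterlockedFamily {
  family :> set path_seq;
  family_nonempty : family !=set0;
  family_interlocked : forall phi1 phi2, family phi1 -> family phi2 ->
    exists2 phi3, family phi3 &
      exists k0, [/\ (ps_start phi3 <= k0)%N, tail_subsequence k0 phi3 phi1
                   & tail_subsequence k0 phi3 phi2] }.

Section ArcIntegral.
Variables (p : nat) (R : realType) (C : Cp_model p R).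

Definition arc_average (a b : C) (f : C -> C) (phi : path_seq) (k : nat) : C :=
  (p%:R ^+ phi k)^-1 *
  \sum_(z \in [set z : C | z ^+ (p ^ phi k) = 1])
     (let x := a + (b - a) * z in (x - a) * f x).

Definition is_arc_integral (a b : C) (Phi : interlocked_family) (f : C -> C) (L : C)
    : Prop :=
  forall eps : R, 0 < eps ->
    exists2 phi : path_seq, family Phi phi &
      exists K : nat, forall k, (ps_start phi <= k)%N -> (K < k)%N ->
        Cp_abs (arc_average a b f phi k - L) < eps.

End ArcIntegral.

Definition Phi_set (alpha : int) : set path_seq :=
  [set phi | exists2 lambda : nat, (0 < lambda)%N &
     forall k, (ps_start phi <= k)%N -> (phi k)%:Z = alpha + (lambda * k)%N%:Z].

Section Phi.
Variable alpha : int.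

Section Affine.
Variables (lambda : nat) (lambda_gt0 : (0 < lambda)%N).

Let affine k := absz (alpha + (lambda * k)%N%:Z).
Let start := (absz alpha).+1%N.

Let affineE k : (start <= k)%N -> (affine k)%:Z = alpha + (lambda * k)%N%:Z.
Proof. rewrite /affine /start; nia. Qed.

Let affine_gt0 k : (start <= k)%N -> (0 < affine k)%N.
Proof. rewrite /affine /start; nia. Qed.

Let affine_increasing j k : (start <= j)%N -> (j < k)%N -> (affine j < affine k)%N.
Proof.
move=> sj jk; have := affineE sj; have := affineE (leq_trans sj (ltnW jk)).
have : (lambda * j < lambda * k)%N by rewrite ltn_pmul2l.
by lia.
Qed.

Definition affine_path_seq : path_seq :=
  @PathSeq start affine isT affine_gt0 affine_increasing.

Lemma affine_path_seqP k :
  (ps_start affine_path_seq <= k)%N ->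
  (affine_path_seq k)%:Z = alpha + (lambda * k)%N%:Z.
Proof. exact: affineE. Qed.

Lemma Phi_affine : Phi_set alpha affine_path_seq.
Proof. by exists lambda => // k; exact: affineE. Qed.

End Affine.

Lemma Phi_nonempty : Phi_set alpha !=set0.
Proof. by exists (affine_path_seq (ltn0Sn 0)); exact: Phi_affine. Qed.

Lemma tail_subsequence_affine (phi : path_seq) (l n k0 : nat) (ln_gt0 : (0 < l * n)%N) :
  (forall k, (ps_start phi <= k)%N -> (phi k)%:Z = alpha + (l * k)%N%:Z) ->
  ((absz alpha).+1 <= k0)%N -> (ps_start phi <= k0)%N ->
  tail_subsequence k0 (affine_path_seq ln_gt0) phi.
Proof.
move=> phiE ak0 sk0; have n_gt0 : (0 < n)%N by move: ln_gt0; case: (n); lia.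
have sn k : (k0 <= k)%N -> (ps_start phi <= n * k)%N.
  by move=> k0k; apply: leq_trans sk0 (leq_trans k0k _); rewrite leq_pmull.
exists (fun k => n * k)%N; split=> // [j k _ jk|k k0k]; first by rewrite ltn_pmul2l.
have := @affine_path_seqP _ ln_gt0 k (leq_trans ak0 k0k).
by have := phiE _ (sn k k0k); rewrite mulnA => <- [].
Qed.

Lemma Phi_interlocked phi1 phi2 : Phi_set alpha phi1 -> Phi_set alpha phi2 ->
  exists2 phi3, Phi_set alpha phi3 &
    exists k0, [/\ (ps_start phi3 <= k0)%N, tail_subsequence k0 phi3 phi1
                 & tail_subsequence k0 phi3 phi2].
Proof.
move=> [l1 l1_gt0 phi1E] [l2 l2_gt0 phi2E].
have l12_gt0 : (0 < l1 * l2)%N by nia.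
exists (affine_path_seq l12_gt0); first exact: Phi_affine.
exists ((absz alpha).+1 + ps_start phi1 + ps_start phi2)%N; split.
- by rewrite /=; lia.
- by apply: tail_subsequence_affine phi1E _ _; lia.
- move: (l12_gt0); rewrite mulnC => l21_gt0.
  have [s [s1 s2 s3]] : tail_subsequence ((absz alpha).+1 + ps_start phi1 + ps_start phi2)
      (affine_path_seq l21_gt0) phi2 by apply: tail_subsequence_affine phi2E _ _; lia.
  by exists s; split=> // k /s3 <- /=; rewrite mulnC.
Qed.

Definition Phi_ : interlocked_family :=
  InterlockedFamily Phi_nonempty Phi_interlocked.

End Phi.

(* Main.v *)
(** A rational function with poles [d] has arc integral [sum Res_d * c(d)], where
    [c(d)] depends only on the residue class of [w = (d - a) / (b - a)]: averaging
    [(x - a) / (x - d)] over the [N]-th roots of unity gives exactly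
    [1 / (1 - w ^ N)], which along [N = p ^ (alpha + s k)] tends to 0 if [|w| > 1]
    and to [1 / (1 - t ^ (p ^ alpha))] if [|w| <= 1], where [t] is the Teichmuller
    representative of [w]. The constants [mu] solve the linear system relating the
    [c] of the outer arc to those of the inner arcs; modulo the maximal ideal its
    matrix is a Frobenius twist of a Cauchy matrix, hence invertible.

    Passing from rational functions to their uniform limits needs
    [|average of f| <= |b - a| * sup |f|] on the arc, uniformly in [N] although the
    average divides by [N]. If [f = sum c_n (z - 1)^n] on the open unit disc then
    [|c_n| <= sup |f|], and the averages of [z (z - 1)^n] are integers. The same
    bound reduces multiple poles to limits of simple ones. *)
Require Import Defs.
From HB Require Import structures.
From mathcomp Require Import all_boot all_order all_algebra.
From mathcomp Require Import boolp classical_sets functions cardinality fsbigop reals.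
From mathcomp Require Import cyclic separable cyclotomic.
From mathcomp Require Import ring lra zify.

Set Implicit Arguments.
Unset Strict Implicit.
Unset Printing Implicit Defensive.

Import Order.TTheory GRing.Theory Num.Theory.

Local Open Scope classical_set_scope.
Local Open Scope ring_scope.

(** * Ultrametric absolute values *)

(* Three obstacles shape the development. The field is given only as a completion of an algebraic
   closure, so the roots that split denominators, the roots of unity and the elements of absolute
   value just below 1 all have to be produced by approximation. Next, a Teichmuller representative
   is only periodic under Frobenius, with a period depending on its residue class, while one step
   [s] must serve every arc and every [f]. This works because all poles in one hole share the
   residue class of the coordinate of its center, for each arc whose closed disc contains that
   center; finitely many classes remain. Poles beyond the outer circle have limit 0 on every arc, so
   the linear system has one equation per hole and is square. Finally, the constants may depend on
   circles and arcs only as sets. A set determines a center or base point only up to a distance less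
   than the radius, and this moves coordinates by less than 1 in absolute value, a change that
   [c(d)] does not see. *)
Existing Class is_ultrametric_abs.

Section UltrametricAbs.
Variables (R : realType) (F : fieldType) (v : F -> R).
Context {vP : is_ultrametric_abs v}.
Implicit Types (x y z : F) (e : R).

Lemma uabs_ge0 x : 0 <= v x. Proof. exact: abs_ge0. Qed.

Lemma uabs0 : v 0 = 0. Proof. by apply/(abs_eq0 vP). Qed.

Lemma uabs_eq0 x : (v x == 0) = (x == 0).
Proof. by apply/eqP/eqP => /(abs_eq0 vP). Qed.

Lemma uabs_gt0 x : (0 < v x) = (x != 0).
Proof. by rewrite lt_neqAle uabs_ge0 andbT eq_sym uabs_eq0. Qed.

Lemma uabsM x y : v (x * y) = v x * v y. Proof. exact: absM. Qed.

Lemma uabs1 : v 1 = 1.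
Proof.
have n0 : v 1 != 0 by rewrite uabs_eq0 oner_eq0.
by apply: (mulfI n0); rewrite -uabsM !mulr1.
Qed.

Lemma uabsX x n : v (x ^+ n) = v x ^+ n.
Proof. by elim: n => [|n IH]; rewrite ?expr0 ?uabs1 // !exprS uabsM IH. Qed.

Lemma uabsN x : v (- x) = v x.
Proof.
have : v (-1) ^+ 2 == 1 by rewrite -uabsX sqrrN expr1n uabs1.
rewrite sqrp_eq1 ?uabs_ge0 // => /eqP vN1.
by rewrite -mulN1r uabsM vN1 mul1r.
Qed.

Lemma uabs_subC x y : v (x - y) = v (y - x).
Proof. by rewrite -uabsN opprB. Qed.

Lemma uabsV x : v x^-1 = (v x)^-1.
Proof.
have [->|x0] := eqVneq x 0; first by rewrite !invr0 uabs0 invr0.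
have vx0 : v x != 0 by rewrite uabs_eq0.
by apply: (mulfI vx0); rewrite -uabsM !mulfV // uabs1.
Qed.

Lemma uabs_div x y : v (x / y) = v x / v y.
Proof. by rewrite uabsM uabsV. Qed.

Lemma uabs_prod I (s : seq I) (P : pred I) (f : I -> F) :
  v (\prod_(i <- s | P i) f i) = \prod_(i <- s | P i) v (f i).
Proof. exact: (big_morph v uabsM uabs1). Qed.

Lemma uabsD_le x y e : v x <= e -> v y <= e -> v (x + y) <= e.
Proof. by move=> xe ye; rewrite (le_trans (abs_ultra vP x y)) // ge_max xe. Qed.

Lemma uabsD_lt x y e : v x < e -> v y < e -> v (x + y) < e.
Proof. by move=> xe ye; rewrite (le_lt_trans (abs_ultra vP x y)) // gt_max xe. Qed.

Lemma uabsB_le x y e : v x <= e -> v y <= e -> v (x - y) <= e.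
Proof. by move=> xe ye; rewrite uabsD_le ?uabsN. Qed.

Lemma uabsB_lt x y e : v x < e -> v y < e -> v (x - y) < e.
Proof. by move=> xe ye; rewrite uabsD_lt ?uabsN. Qed.

Lemma uabs_dist_le x y z e : v (x - y) <= e -> v (y - z) <= e -> v (x - z) <= e.
Proof. by move=> xe ye; rewrite -(subrK y x) -addrA uabsD_le. Qed.

Lemma uabs_dist_lt x y z e : v (x - y) < e -> v (y - z) < e -> v (x - z) < e.
Proof. by move=> xe ye; rewrite -(subrK y x) -addrA uabsD_lt. Qed.

Lemma uabs_sum_le I (s : seq I) (P : pred I) (f : I -> F) e : 0 <= e ->
  (forall i, P i -> v (f i) <= e) -> v (\sum_(i <- s | P i) f i) <= e.
Proof.
by move=> e0 fe; elim/big_rec: _ => [|i y Pi ye]; rewrite ?uabs0 ?uabsD_le ?fe.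
Qed.

Lemma uabs_sum_lt I (s : seq I) (P : pred I) (f : I -> F) e : 0 < e ->
  (forall i, P i -> v (f i) < e) -> v (\sum_(i <- s | P i) f i) < e.
Proof.
by move=> e0 fe; elim/big_rec: _ => [|i y Pi ye]; rewrite ?uabs0 ?uabsD_lt ?fe.
Qed.

Lemma uabs_dominant x y : v x < v y -> v (x + y) = v y.
Proof.
move=> xy; apply/eqP; rewrite eq_le (uabsD_le (ltW xy)) //= leNgt; apply/negP => lt_y.
by have := uabsB_lt lt_y xy; rewrite [x + y]addrC addrK ltxx.
Qed.

Lemma uabs_near x y : v (x - y) < v y -> v x = v y.
Proof. by move=> /uabs_dominant; rewrite subrK. Qed.

Lemma uabs_nat_le1 n : v n%:R <= 1.
Proof. by elim: n => [|n IH]; rewrite ?uabs0 // -addn1 natrD uabsD_le ?uabs1. Qed.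

Lemma uabsX_le1 x n : v x <= 1 -> v (x ^+ n) <= 1.
Proof. by move=> x1; rewrite uabsX exprn_ile1 ?uabs_ge0. Qed.

Lemma uabsM_le1 x y : v x <= 1 -> v y <= 1 -> v (x * y) <= 1.
Proof. by move=> x1 y1; rewrite uabsM mulr_ile1 ?uabs_ge0. Qed.

End UltrametricAbs.

Lemma expr_lt_eventually (R : realType) (t e : R) : 0 <= t < 1 -> 0 < e ->
  exists K, forall k, (K <= k)%N -> t ^+ k < e.
Proof.
move=> /andP[t0 t1] e0.
have [->|tn0] := eqVneq t 0.
  by exists 1%N => -[|k] // _; rewrite expr0n.
have tp : 0 < t by rewrite lt_neqAle eq_sym tn0.
have bern h n : 0 <= h -> 1 + h *+ n <= (1 + h) ^+ n :> R.
  move=> h0; elim: n => [|n IH]; first by rewrite addr0.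
  rewrite exprS mulrDl mul1r mulrS addrCA [leLHS]addrC lerD //.
  by rewrite ler_peMr // (le_trans _ IH) // lerDl mulrn_wge0.
pose h := t^-1 - 1.
have h0 : 0 < h by rewrite subr_gt0 invf_gt1.
exists (Num.bound (e^-1 / h)) => k Kk.
have hk : e^-1 < h *+ k.
  rewrite -mulr_natr mulrC -ltr_pdivrMr //.
  apply: lt_le_trans (archi_boundP _) _; last by rewrite ler_nat.
  by apply: divr_ge0; rewrite ltW ?invr_gt0.
rewrite -[ltLHS]invrK -[ltRHS]invrK ltf_pV2 ?posrE ?invr_gt0 ?exprn_gt0 //.
rewrite -exprVn; apply: lt_le_trans hk _.
have -> : t^-1 = 1 + h by rewrite addrC subrK.
by apply: le_trans (bern _ _ (ltW h0)); rewrite lerDr.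
Qed.

(** * Frobenius congruences on the closed unit disc *)

Section Frobenius.
Variables (R : realType) (F : fieldType) (v : F -> R).
Context {vP : is_ultrametric_abs v}.
Variables (p : nat) (p_prime : prime p).
Hypothesis vp : v p%:R < 1.
Implicit Types x y : F.

Let p_gt1 := prime_gt1 p_prime.

(** The middle binomial coefficients are divisible by [p], and each middle term still contains a
    factor [y]. Keeping that factor is what turns the next estimate into a contraction. *)
Lemma exprD_prime x y : v x <= 1 -> v y <= 1 ->
  v ((x + y) ^+ p - (x ^+ p + y ^+ p)) <= v p%:R * v y.
Proof.
move=> x1 y1; have p0 := prime_gt0 p_prime.
rewrite exprDn -(big_mkord xpredT (fun i => x ^+ (p - i) * y ^+ i *+ 'C(p, i))).
rewrite big_nat_recr //= big_ltn // subn0 expr0 mulr1 bin0 subnn expr0 mul1r binn.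
rewrite !mulr1n; set S := \sum_(_ <= _ < _) _.
rewrite (_ : _ - _ = S); last by ring.
rewrite /S big_nat.
apply: uabs_sum_le => [|i /andP[i0 ip]]; first by rewrite mulr_ge0 ?uabs_ge0.
have /dvdnP[c ->] : (p %| 'C(p, i))%N by rewrite prime_dvd_bin ?i0.
rewrite -mulr_natl natrM !uabsM [_ * v p%:R]mulrC -!mulrA.
rewrite ler_wpM2l ?uabs_ge0 // -(prednK i0) exprSr uabsM !mulrA.
rewrite ler_piMl ?uabs_ge0 // !mulr_ile1 ?mulr_ge0 ?uabs_ge0 ?uabs_nat_le1 //.
  exact: uabsX_le1.
exact: uabsX_le1.
Qed.

(** Expanding [x = y + (x - y)] leaves [(x - y) ^+ p], at least quadratic in the distance, and an
    error of size [|p| |x - y|]. *)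
Lemma expr_prime_contract x y : v x <= 1 -> v y <= 1 ->
  v (x ^+ p - y ^+ p) <= v (x - y) * Num.max (v (x - y)) (v p%:R).
Proof.
move=> x1 y1.
have d1 : v (x - y) <= 1 by rewrite uabsB_le.
have := exprD_prime y1 d1; rewrite (addrC y) subrK => h.
have -> : x ^+ p - y ^+ p = (x - y) ^+ p + (x ^+ p - (y ^+ p + (x - y) ^+ p)) by ring.
apply: uabsD_le.
  rewrite uabsX -(subnKC p_gt1) exprD expr2 -mulrA ler_wpM2l ?uabs_ge0 //.
  by rewrite le_max ler_piMr ?uabs_ge0 // exprn_ile1 ?uabs_ge0.
by rewrite (le_trans h) // mulrC ler_wpM2l ?uabs_ge0 // le_max lexx orbT.
Qed.

Lemma expr_pX_contract n x y : v x <= 1 -> v y <= 1 ->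
  v (x ^+ (p ^ n) - y ^+ (p ^ n)) <=
    v (x - y) * Num.max (v (x - y)) (v p%:R) ^+ n.
Proof.
move=> x1 y1; set t := Num.max _ _.
have t0 : 0 <= t by rewrite le_max uabs_ge0.
have t1 : t <= 1 by rewrite ge_max uabsB_le // ltW.
elim: n => [|n IH]; first by rewrite expn0 !expr1 expr0 mulr1.
rewrite expnSr !exprM exprSr.
apply: le_trans (expr_prime_contract _ _) _; rewrite ?uabsX_le1 // mulrA.
apply: ler_pM => //; rewrite ?[0 <= Num.max _ _]le_max ?uabs_ge0 //.
rewrite ge_max !le_max lexx orbT andbT.
by rewrite (le_trans IH) // ler_piMr ?uabs_ge0 ?exprn_ile1.
Qed.

Lemma expr_pX_dist_le n x y : v x <= 1 -> v y <= 1 ->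
  v (x ^+ (p ^ n) - y ^+ (p ^ n)) <= v (x - y).
Proof.
move=> x1 y1; apply: le_trans (expr_pX_contract n x1 y1) _.
rewrite ler_piMr ?uabs_ge0 // exprn_ile1 ?le_max ?uabs_ge0 //.
by rewrite ge_max uabsB_le // ltW.
Qed.

Lemma expr_pX_dist_null x y e : v x <= 1 -> v y <= 1 -> v (x - y) < 1 -> 0 < e ->
  exists K, forall n, (K <= n)%N -> v (x ^+ (p ^ n) - y ^+ (p ^ n)) < e.
Proof.
move=> x1 y1 xy e0; set t := Num.max (v (x - y)) (v p%:R).
have [|K HK] := @expr_lt_eventually R t e _ e0.
  by rewrite le_max uabs_ge0 /= gt_max xy vp.
exists K => n Kn; apply: le_lt_trans (expr_pX_contract n x1 y1) _.
apply: le_lt_trans (HK n Kn); rewrite ler_piMl ?(ltW xy) //.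
by rewrite exprn_ge0 // le_max uabs_ge0.
Qed.

(** Raising to the [p]-th power does not increase distances in the unit disc, so the error of one
    step does not accumulate under iteration. *)
Lemma exprD_pX n x y : v x <= 1 -> v y <= 1 ->
  v ((x + y) ^+ (p ^ n) - (x ^+ (p ^ n) + y ^+ (p ^ n))) <= v p%:R.
Proof.
move=> x1 y1; elim: n => [|n IH]; first by rewrite expn0 !expr1 subrr uabs0 uabs_ge0.
rewrite expnSr !exprM.
have xn : v (x ^+ (p ^ n)) <= 1 by rewrite uabsX_le1.
have yn : v (y ^+ (p ^ n)) <= 1 by rewrite uabsX_le1.
have xyn : v ((x + y) ^+ (p ^ n)) <= 1 by rewrite uabsX_le1 // uabsD_le.
apply: (@uabs_dist_le _ _ _ _ _ ((x ^+ (p ^ n) + y ^+ (p ^ n)) ^+ p)).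
  apply: le_trans (expr_prime_contract _ _) _; rewrite ?uabsD_le //.
  apply: (le_trans _ IH); rewrite ler_piMr ?uabs_ge0 //.
  by rewrite ge_max (ltW vp) uabsB_le // uabsD_le.
apply: le_trans (exprD_prime _ _) _ => //.
by rewrite ler_piMr ?uabs_ge0.
Qed.

Hypothesis p_odd : odd p.

Lemma exprB_pX n x y : v x <= 1 -> v y <= 1 ->
  v ((x - y) ^+ (p ^ n) - (x ^+ (p ^ n) - y ^+ (p ^ n))) <= v p%:R.
Proof.
move=> x1 y1; have Ny1 : v (- y) <= 1 by rewrite uabsN.
by have := exprD_pX n x1 Ny1; rewrite exprNn -signr_odd oddX p_odd orbT mulN1r.
Qed.

End Frobenius.

(** * Estimates for polynomials over an ultrametric field *)

Section PolyBounds.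
Variables (R : realType) (F : fieldType) (v : F -> R).
Context {vP : is_ultrametric_abs v}.
Implicit Types (P Q : {poly F}) (x : F).

Lemma uabs_horner_le P n x e B : (size P <= n.+1)%N -> 0 <= e -> 1 <= B ->
  (forall i, v P`_i <= e) -> v x <= B -> v P.[x] <= e * B ^+ n.
Proof.
move=> sP e0 B1 Pe xB; have B0 := le_trans ler01 B1.
rewrite (horner_coef_wide _ sP); apply: uabs_sum_le => [|i _].
  by rewrite mulr_ge0 ?exprn_ge0.
rewrite uabsM ler_pM ?uabs_ge0 // uabsX.
by rewrite (le_trans (lerXn2r _ _ _ xB)) ?nnegrE ?uabs_ge0 // ler_weXn2l // -ltnS.
Qed.

Lemma uabs_horner_le1 P x e : 0 <= e -> (forall i, v P`_i <= e) -> v x <= 1 ->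
  v P.[x] <= e.
Proof.
move=> e0 Pe x1; have := uabs_horner_le (leqSpred _) e0 (lexx 1) Pe x1.
by rewrite expr1n mulr1; apply.
Qed.

Lemma uabs_horner_dist P n x y e B : (size P <= n.+1)%N -> 0 <= e -> 1 <= B ->
  (forall i, v P`_i <= e) -> v x <= B -> v y <= B ->
  v (P.[x] - P.[y]) <= e * B ^+ n * v (x - y).
Proof.
move=> sP e0 B1 Pe xB yB; have B0 := le_trans ler01 B1.
rewrite !(horner_coef_wide _ sP) -sumrB; apply: uabs_sum_le => [|i _].
  by rewrite !mulr_ge0 ?exprn_ge0 ?uabs_ge0.
rewrite -mulrBr subrXX [(x - y) * _]mulrC !uabsM mulrA ler_wpM2r ?uabs_ge0 //.
rewrite ler_pM ?uabs_ge0 //; apply: uabs_sum_le => [|j _]; first exact: exprn_ge0.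
rewrite uabsM !uabsX; have [ji iN] := (ltn_ord j, ltn_ord i).
apply: (@le_trans _ _ (B ^+ (i.-1 - j) * B ^+ j)).
  by rewrite ler_pM ?exprn_ge0 ?uabs_ge0 // lerXn2r ?nnegrE ?uabs_ge0.
by rewrite -exprD ler_weXn2l //; lia.
Qed.

Lemma uabs_coefM P Q a b : (forall i, v P`_i <= a) -> (forall i, v Q`_i <= b) ->
  forall i, v (P * Q)`_i <= a * b.
Proof.
move=> Pa Qb i; have a0 : 0 <= a by apply: le_trans (Pa 0%N); apply: uabs_ge0.
have b0 : 0 <= b by apply: le_trans (Qb 0%N); apply: uabs_ge0.
rewrite coefM; apply: uabs_sum_le => [|j _]; first exact: mulr_ge0.
by rewrite uabsM ler_pM ?uabs_ge0.
Qed.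

Lemma uabs_coefX_le1 P n : (forall i, v P`_i <= 1) -> forall i, v (P ^+ n)`_i <= 1.
Proof.
move=> P1; elim: n => [|n IH] i.
  by rewrite expr0 coef1; apply: uabs_nat_le1.
by rewrite exprS -[leRHS]mulr1; apply: uabs_coefM.
Qed.

Lemma uabs_coef_comp P Q e : 0 <= e -> (forall i, v P`_i <= e) ->
  (forall i, v Q`_i <= 1) -> forall i, v (P \Po Q)`_i <= e.
Proof.
move=> e0 Pe Q1 i; rewrite comp_polyE coef_sum; apply: uabs_sum_le => // j _.
rewrite coefZ uabsM -[e]mulr1 ler_pM ?uabs_ge0 //; exact: uabs_coefX_le1.
Qed.

(** At a point of absolute value above [B >= 1] the leading term would exceed the sum of all the
    others. *)
Lemma uabs_monic_root_le P x B : P \is monic -> 1 <= B ->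
  (forall i, v P`_i <= B) -> root P x -> v x <= B.
Proof.
move=> Pm B1 PB /rootP Px; rewrite leNgt; apply/negP => Bx.
have P0 := monic_neq0 Pm.
have sP : (size P).-1.+1 = size P by rewrite prednK // size_poly_gt0.
have x1 : 1 < v x := le_lt_trans B1 Bx.
have x0 : 0 < v x := lt_trans ltr01 x1.
have [n1|n1] := leqP (size P) 1.
  move: Px; rewrite (size1_polyC n1) hornerC => P0z.
  by move: P0; rewrite (size1_polyC n1) P0z eqxx.
have : v (x ^+ (size P).-1) <= B * v x ^+ (size P).-2.
  move: Px; rewrite horner_coef -sP big_ord_recr /= -lead_coefE (monicP Pm) mul1r.
  move/eqP; rewrite addr_eq0 => /eqP Px; rewrite -[_ ^+ _]opprK -Px uabsN.
  apply: uabs_sum_le => [|i _]; first by rewrite mulr_ge0 ?exprn_ge0 ?uabs_ge0 // (le_trans _ B1).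
  rewrite uabsM ler_pM ?uabs_ge0 // uabsX ler_weXn2l ?(ltW x1) //.
  by have := ltn_ord i; lia.
have [n ->] : exists n, size P = n.+2 by exists (size P).-2; lia.
rewrite uabsX /= exprS ler_pM2r ?exprn_gt0 //.
by rewrite leNgt Bx.
Qed.

Lemma uabs_coef_le_horner P e :
  (forall t : R, 0 <= t < 1 -> exists y : F, t < v y < 1) ->
  (forall x, v x < 1 -> v P.[x] <= e) -> forall i, v P`_i <= e.
Proof.
(* the coefficient of largest absolute value and smallest index dominates
   [P.[x]] when [v x] is close enough to 1 *)
move=> near1 Pe; pose m := \big[Num.max/0]_(i < size P) v P`_i.
have e0 : 0 <= e by apply: le_trans (Pe 0 _); rewrite ?uabs_ge0 // uabs0.
have lem i : v P`_i <= m.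
  have [si|si] := ltnP i (size P); last by rewrite nth_default // uabs0 /m; apply: bigmax_ge_id.
  by rewrite /m (bigD1 (Ordinal si)) //= le_max lexx.
suff me : m <= e by move=> i; apply: le_trans me.
rewrite leNgt; apply/negP => em; have m0 := le_lt_trans e0 em.
have exm : exists n, v P`_n == m.
  have [/existsP[i Pi]|] := boolP [exists i : 'I_(size P), v P`_i == m]; first by exists i.
  rewrite negb_exists => /forallP Pm; have : m < m; last by rewrite ltxx.
  by rewrite {1}/m; apply: bigmax_lt => // i _; rewrite lt_neqAle Pm lem.
case: (ex_minnP exm) => J /eqP PJ minJ.
pose m' := Num.max e (\big[Num.max/0]_(i < J) v P`_i).
have m'm : m' < m.
  rewrite gt_max em; apply: bigmax_lt => // i _; rewrite lt_neqAle lem andbT.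
  by apply/negP => /minJ; rewrite leqNgt ltn_ord.
have m'0 : 0 <= m' by rewrite le_max e0.
have [t /andP[t0 t1] tJ] : exists2 t : R, 0 <= t < 1 & forall s, t < s -> m' < m * s ^+ J.
  (* Bernoulli gives [(1 - h) ^ J >= 1 - J h > m' / m]; the denominator [J + 1] instead of [J] makes
     the last inequality strict and covers [J = 0]. *)
  pose h := (1 - m' / m) / J.+1%:R.
  have q1 : 0 < 1 - m' / m by rewrite subr_gt0 ltr_pdivrMr // mul1r.
  have q1' : 1 - m' / m <= 1 by rewrite gerBl divr_ge0 // ltW.
  have h0 : 0 < h by rewrite divr_gt0.
  have h1 : h <= 1.
    by rewrite ler_pdivrMr // mul1r (le_trans q1') // ler1n.
  exists (1 - h); first by rewrite subr_ge0 h1 gtrBl h0.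
  move=> s hs; rewrite -ltr_pdivrMl // mulrC.
  have bern k : 1 - h *+ k <= (1 - h) ^+ k.
    elim: k => [|k IH]; first by rewrite subr0.
    rewrite exprS; apply: le_trans (ler_wpM2l _ IH); last by rewrite subr_ge0.
    rewrite mulrBr mulr1 mulrBl mul1r mulrS opprD addrA lerD2l lerN2 gerBl.
    by rewrite mulr_ge0 ?mulrn_wge0 ?ltW.
  apply: (@lt_le_trans _ _ ((1 - h) ^+ J)).
    apply: lt_le_trans (bern J); rewrite ltrBrDr -ltrBrDl -mulr_natr /h -mulrA.
    by rewrite gtr_pMr // mulrC ltr_pdivrMr // mul1r ltr_nat.
  by rewrite lerXn2r ?nnegrE ?subr_ge0 // ?ltW // (le_lt_trans _ hs) // subr_ge0.
have [|y /andP[ty y1]] := near1 t; first by rewrite t0.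
have y0 : 0 < v y := le_lt_trans t0 ty.
have sJ : (J < size P)%N.
  by rewrite ltnNge; apply/negP => sJ; move: m0; rewrite -PJ nth_default // uabs0 ltxx.
have : v P.[y] = m * v y ^+ J.
  rewrite horner_coef (bigD1 (Ordinal sJ)) //= addrC.
  rewrite uabs_dominant uabsM uabsX ?PJ //.
  apply: uabs_sum_lt => [|i iJ]; first by rewrite mulr_gt0 ?exprn_gt0.
  rewrite uabsM uabsX.
  have [lt_iJ|] := ltnP i J.
    apply: le_lt_trans (tJ _ ty); rewrite -[leRHS]mulr1.
    rewrite ler_pM ?exprn_ge0 ?exprn_ile1 ?(ltW y1) ?uabs_ge0 // le_max.
    by rewrite /m' (bigD1 (Ordinal lt_iJ)) //= le_max lexx orbT.
  rewrite leq_eqVlt eq_sym => /orP[/eqP iE|lt_Ji].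
    by case/eqP: iJ; apply: val_inj.
  apply: le_lt_trans (_ : m * v y ^+ i < _); first by rewrite ler_wpM2r ?exprn_ge0 ?uabs_ge0.
  by rewrite ltr_pM2l // ltr_iXn2l.
by move=> vPy; have := Pe _ y1; rewrite vPy leNgt (le_lt_trans _ (tJ _ ty)) // le_max lexx.
Qed.

End PolyBounds.

(** * Arithmetic of C_p *)

Instance Cp_absP p R (C : Cp_model p R) : is_ultrametric_abs (@Cp_abs p R C) :=
  completion_abs (Cp_completion C).

Instance Qpbar_absP p R (C : Cp_model p R) : is_ultrametric_abs (@Qpbar_abs p R C) :=
  Qpbar_abs_axiom C.

Instance Qp_absP p R (C : Cp_model p R) : is_ultrametric_abs (@Qp_abs p R C) :=
  completion_abs (Qp_completion C).

Section CpArithmetic.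
Variables (p : nat) (p_prime : prime p) (R : realType) (C : Cp_model p R).

Lemma padic_abs_p : padic_abs R p p%:R = p%:R^-1.
Proof.
have p0 : p%:R != 0 :> rat by rewrite pnatr_eq0 -lt0n prime_gt0.
rewrite /padic_abs (negbTE p0) (pmulrn (1 : rat)) numq_int denq_int /=.
by rewrite logn1 expr0 mul1r logn_prime // eqxx expr1.
Qed.

Lemma Qp_abs_p : Qp_abs (p%:R : Qp C) = p%:R^-1.
Proof.
by rewrite -(rmorph_nat (@Qp_of_rat _ _ C)) (completion_isometry (Qp_completion C)) padic_abs_p.
Qed.

Lemma Cp_abs_p : Cp_abs (p%:R : C) = p%:R^-1.
Proof.
rewrite -(rmorph_nat (@Cp_of_Qpbar _ _ C)) (completion_isometry (Cp_completion C)).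
by rewrite -(rmorph_nat (@Qpbar_of_Qp _ _ C)) Qpbar_abs_extends Qp_abs_p.
Qed.

Lemma p_gt1R : 1 < p%:R :> R.
Proof. by rewrite ltr1n prime_gt1. Qed.

Lemma Cp_abs_p_lt1 : Cp_abs (p%:R : C) < 1.
Proof. by rewrite Cp_abs_p invf_lt1 ?p_gt1R // (lt_trans ltr01) ?p_gt1R. Qed.

Lemma Cp_natr_neq0 n : (0 < n)%N -> n%:R != 0 :> C.
Proof.
move=> n0; rewrite -(rmorph_nat (@Cp_of_Qpbar _ _ C)) fmorph_eq0.
rewrite -(rmorph_nat (@Qpbar_of_Qp _ _ C)) fmorph_eq0.
by rewrite -(rmorph_nat (@Qp_of_rat _ _ C)) fmorph_eq0 pnatr_eq0 -lt0n.
Qed.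

Lemma uabs_int_le1 (F : fieldType) (v : F -> R) (vP : is_ultrametric_abs v) (z : int) :
  v z%:~R <= 1.
Proof.
case: z => n; first by rewrite -pmulrn; apply: uabs_nat_le1.
by rewrite NegzE mulrNz uabsN -pmulrn; apply: uabs_nat_le1.
Qed.

(** A rational [q] close to [x] has a denominator prime to [p]. The Bezout relation
    [u p + w denq q = 1], multiplied by [q], exhibits the integer [w numq q] as congruent to [q]
    modulo [p]. *)
Lemma Qp_residue (x : Qp C) : Qp_abs x <= 1 -> exists z : int, Qp_abs (x - z%:~R) < 1.
Proof.
move=> x1; have [q xq] := completion_dense (Qp_completion C) x ltr01.
have p0 := prime_gt0 p_prime.
have qq1 : Qp_abs (Qp_of_rat C q) <= 1.
  rewrite -(subKr x (Qp_of_rat C q)).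
  by apply: uabsB_le => //; apply: ltW.
have q1 : padic_abs R p q <= 1 by rewrite -(completion_isometry (Qp_completion C)).
have cpq : coprimez p (denq q).
  rewrite coprimezE /= prime_coprime //; apply/negP => pd.
  move: q1; rewrite /padic_abs; have [q0|q0] := eqVneq q 0.
    by move: pd; rewrite q0 dvdn1 => /eqP p1; move: p_prime; rewrite p1.
  have := coprime_num_den q; have [pn|pn _] := boolP (p %| `|numq q|)%N.
    rewrite /coprime => /eqP g1; have : (p %| 1)%N by rewrite -g1 dvdn_gcd pn pd.
    by rewrite dvdn1 => /eqP p1; move: p_prime; rewrite p1.
  rewrite [logn p `|numq q|]lognE p_prime absz_gt0 numq_eq0 q0 (negbTE pn) expr0 divr1.
  rewrite leNgt exprn_egt1 ?p_gt1R // -lt0n logn_gt0 mem_primes p_prime pd.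
  by rewrite absz_gt0 denq_neq0.
have /coprimezP[[u w] /= uw] := cpq.
have qE : q = (w * numq q)%:~R + u%:~R * (p%:R * q).
  have e1 : u%:~R * p%:R + w%:~R * (denq q)%:~R = 1 :> rat.
    by rewrite (pmulrn (1 : rat)) -!intrM -intrD uw.
  have e2 : q * (denq q)%:~R = (numq q)%:~R.
    by rewrite -{1}(divq_num_den q) divfK // intr_eq0 denq_neq0.
  have := congr1 ( *%R^~ q) e1; rewrite /= mul1r mulrDl => e3; rewrite -[LHS]e3.
  by rewrite intrM -e2 (mulrC q) addrC !mulrA.
exists (w * numq q)%R; rewrite -(subrK (Qp_of_rat C q) x) -addrA; apply: uabsD_lt => //.
rewrite {1}qE rmorphD !rmorphM /= rmorph_nat !rmorph_int [_ + _ * _]addrC addrK.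
rewrite !uabsM Qp_abs_p mulrCA; apply: (@le_lt_trans _ _ (p%:R^-1)).
  by rewrite ler_piMr ?invr_ge0 ?ler0n // mulr_ile1 ?uabs_ge0 ?uabs_int_le1.
by rewrite invf_lt1 ?p_gt1R // (lt_trans ltr01) ?p_gt1R.
Qed.

Let QpC (x : Qp C) : C := Cp_of_Qpbar C (Qpbar_of_Qp C x).

Lemma Cp_abs_Qp x : Cp_abs (QpC x) = Qp_abs x.
Proof. by rewrite /QpC (completion_isometry (Cp_completion C)) Qpbar_abs_extends. Qed.

Lemma Cp_monic_int_root (w : C) : Cp_abs w <= 1 ->
  exists2 M : {poly int}, M \is monic & Cp_abs (map_poly intr M).[w] < 1.
Proof.
move=> w1; have [w0 ww0] := completion_dense (Cp_completion C) w ltr01.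
have [P P0 /rootP Pw] := Qpbar_algebraic w0.
have w01 : Cp_abs (Cp_of_Qpbar C w0) <= 1.
  rewrite -(subKr w (Cp_of_Qpbar C w0)).
  by apply: uabsB_le => //; apply: ltW.
pose a := \big[Num.max/0]_(i < size P) Qp_abs P`_i.
have lea i : Qp_abs P`_i <= a.
  have [si|si] := ltnP i (size P); last by rewrite nth_default // uabs0 /a; apply: bigmax_ge_id.
  by rewrite /a (bigD1 (Ordinal si)) //= le_max lexx.
have a0 : 0 < a.
  by apply: lt_le_trans (lea (size P).-1); rewrite uabs_gt0 -lead_coefE lead_coef_eq0.
have exa : exists d, (d < size P)%N && (Qp_abs P`_d == a).
  have [/existsP[i Pi]|] := boolP [exists i : 'I_(size P), Qp_abs P`_i == a].
    by exists i; rewrite ltn_ord.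
  rewrite negb_exists => /forallP Pm; have : a < a; last by rewrite ltxx.
  by rewrite {1}/a; apply: bigmax_lt => // i _; rewrite lt_neqAle Pm lea.
have ubd d : (d < size P)%N && (Qp_abs P`_d == a) -> (d <= size P)%N by case/andP => /ltnW.
case: (ex_maxnP exa ubd) => d /andP[dP /eqP Pd] maxd.
have Pd0 : P`_d != 0 by rewrite -(@uabs_eq0 _ _ (@Qp_abs _ _ C)) Pd gt_eqF.
pose c i := P`_i / P`_d.
have c1 i : Qp_abs (c i) <= 1 by rewrite uabs_div Pd ler_pdivrMr // mul1r.
have cgt i : (d < i)%N -> Qp_abs (c i) < 1.
  move=> di; rewrite uabs_div Pd ltr_pdivrMr // mul1r lt_neqAle lea andbT.
  have [si|si] := ltnP i (size P); last by rewrite nth_default // uabs0 lt_eqF.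
  by apply/negP => ei; have := maxd i; rewrite si ei leqNgt di => /(_ isT).
have /choice[z zP] := fun i => Qp_residue (c1 i).
pose M : {poly int} := 'X^d + \poly_(i < d) z i.
have Mm : M \is monic.
  by rewrite monicE lead_coefDl ?lead_coefXn // size_polyXn ltnS size_poly.
exists M => //.
have Cw0 : \sum_(i < size P) QpC (c i) * Cp_of_Qpbar C w0 ^+ i = 0.
  move: Pw; rewrite horner_coef size_map_poly => Pw.
  rewrite -[RHS](rmorph0 (@Cp_of_Qpbar _ _ C)) -[in RHS](mulr0 (Qpbar_of_Qp C P`_d)^-1) -Pw.
  rewrite mulr_sumr rmorph_sum; apply: eq_bigr => i _.
  by rewrite /QpC /c -rmorphXn -rmorphM fmorph_div coef_map mulrAC mulrC.
have Mw0 : Cp_abs (map_poly intr M).[Cp_of_Qpbar C w0] < 1.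
  have sM : (size (map_poly intr M : {poly C}) <= size P)%N.
    rewrite (leq_trans (size_poly _ _)) // /M size_polyDl ?size_polyXn //.
    by rewrite ltnS size_poly.
  rewrite -[X in Cp_abs X]subr0 -Cw0 (horner_coef_wide _ sM) -sumrB.
  apply: uabs_sum_lt => // i _; rewrite -mulrBl uabsM.
  apply: le_lt_trans (_ : Cp_abs ((map_poly intr M)`_i - QpC (c i)) < 1).
    by rewrite ler_piMr ?uabs_ge0 ?uabsX_le1.
  rewrite coef_map coefD coefXn coef_poly /=; have [id|di|->] := ltngtP i d.
  - rewrite add0r uabs_subC -(rmorph_int (@Cp_of_Qpbar _ _ C)).
    by rewrite -(rmorph_int (@Qpbar_of_Qp _ _ C)) -!rmorphB [Cp_abs _]Cp_abs_Qp.
  - by rewrite add0r uabsN Cp_abs_Qp cgt.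
  - by rewrite addr0 mulr1z /c divff // /QpC !rmorph1 subrr uabs0.
have -> : (map_poly intr M).[w] = (map_poly intr M).[Cp_of_Qpbar C w0] +
    ((map_poly intr M).[w] - (map_poly intr M).[Cp_of_Qpbar C w0]) by ring.
apply: uabsD_lt => //; apply: (le_lt_trans _ ww0).
apply: le_trans (uabs_horner_dist (leqSpred _) ler01 (lexx 1) _ w1 w01) _.
  by move=> i; rewrite coef_map; apply: uabs_int_le1.
by rewrite expr1n !mul1r uabs_subC.
Qed.

Hypothesis p_odd : odd p.

(** The residue of [w ^ n] depends only on the remainder of [X^n] modulo [M], with coefficients
    taken modulo [p], hence takes at most [p ^ d] values. Among [p ^ d + 1] exponents [p ^ k] two
    agree, and the smaller power of Frobenius can be cancelled because it is additive modulo [p]. *)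
Lemma Cp_residue_algebraic (w : C) : Cp_abs w <= 1 ->
  exists2 s, (0 < s)%N & Cp_abs (w ^+ (p ^ s) - w) < 1.
Proof.
move=> w1; have [M Mm Mw] := Cp_monic_int_root w1.
have evalX n : Cp_abs (w ^+ n - (map_poly intr (Pdiv.Ring.rmodp 'X^n M)).[w]) < 1.
  have /(congr1 (fun P : {poly int} => (map_poly intr P : {poly C}).[w])) :=
    Pdiv.RingMonic.rdivp_eq Mm 'X^n.
  rewrite rmorphD rmorphM /= map_polyXn hornerXn hornerD hornerM => ->.
  rewrite addrK uabsM; apply: le_lt_trans Mw; rewrite ler_piMl ?uabs_ge0 //.
  by apply: uabs_horner_le1 => // i; rewrite coef_map; apply: uabs_int_le1.
pose d := size M; pose r n : {poly int} := Pdiv.Ring.rmodp 'X^n M.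
have p0 : (p : int) != 0 by rewrite -lt0n prime_gt0.
have absp (z : int) : (`|(z %% p)%Z|%N < p)%N.
  by rewrite -ltz_nat gez0_abs ?modz_ge0 // ltz_pmod // ltz_nat prime_gt0.
have sr n : (size (r n) <= d)%N.
  by apply: ltnW; apply: Pdiv.Ring.ltn_rmodpN0; apply: monic_neq0.
pose a n : {ffun 'I_d -> 'I_p} := [ffun i : 'I_d => Ordinal (absp (r n)`_i)].
have eq_near m n : a m = a n -> Cp_abs (w ^+ m - w ^+ n) < 1.
  move=> amn; apply: uabs_dist_lt (evalX m) _.
  apply: (@uabs_dist_lt _ _ _ _ _ (map_poly intr (r n)).[w]); last by rewrite uabs_subC.
  have sM k : (size (map_poly intr (r k) : {poly C}) <= d)%N.
    by rewrite (leq_trans (size_poly _ _)).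
  rewrite !(horner_coef_wide _ (sM _)) -sumrB; apply: uabs_sum_lt => // i _.
  rewrite -mulrBl uabsM.
  apply: le_lt_trans (_ : Cp_abs ((map_poly intr (r m) : {poly C})`_i -
      (map_poly intr (r n) : {poly C})`_i) < 1).
    by rewrite ler_piMr ?uabs_ge0 ?uabsX_le1.
  rewrite !coef_map /= -intrB.
  have : ((r m)`_i = (r n)`_i %[mod p])%Z.
    move/ffunP/(_ i): amn; rewrite !ffunE => /(congr1 val) /= /(congr1 Posz).
    by rewrite !gez0_abs ?modz_ge0.
  move/eqP; rewrite eqz_mod_dvd => /dvdzP[z ->]; rewrite intrM uabsM -[X in _ * Cp_abs X]pmulrn.
  by apply: le_lt_trans Cp_abs_p_lt1; rewrite ler_piMl ?uabs_ge0 ?uabs_int_le1.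
pose f (k : 'I_(p ^ d).+1) := a (p ^ k)%N.
have /injectivePn[k [l kl fkl]] : ~~ injectiveb f.
  apply/negP => /injectiveP /leq_card; rewrite card_ffun !card_ord.
  by rewrite ltnn.
wlog lt_kl : k l kl fkl / (k < l)%N.
  move=> H; have [|lk|/val_inj kl'] := ltngtP k l; first exact: H.
    by apply: (H l k) => //; rewrite eq_sym.
  by rewrite kl' eqxx in kl.
exists (l - k)%N; first by rewrite subn_gt0.
set u := w ^+ _; have u1 : Cp_abs u <= 1 by rewrite uabsX_le1.
have : Cp_abs ((u - w) ^+ (p ^ k)) < 1.
  rewrite -(subrK (u ^+ (p ^ k) - w ^+ (p ^ k)) (_ ^+ _)); apply: uabsD_lt.
    by apply: le_lt_trans Cp_abs_p_lt1; apply: exprB_pX => //; apply: Cp_abs_p_lt1.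
  by rewrite -exprM -expnD subnK ?(ltnW lt_kl) // uabs_subC eq_near.
by rewrite uabsX expr_lt1 ?uabs_ge0 ?expn_gt0 ?prime_gt0.
Qed.

End CpArithmetic.

(** * Algebraic closedness of the completion *)

Section CpClosed.
Variables (p : nat) (R : realType) (C : Cp_model p R).

Let iota := @Cp_of_Qpbar p R C.

(** [|Q(x)|] is the product of the distances from [x] to the roots; if all of them exceeded [t], it
    would exceed [t ^ deg Q]. *)
Let near_root (Q : {poly Qpbar C}) (x : C) (t : R) : Q \is monic -> (1 < size Q)%N ->
  0 <= t -> Cp_abs (map_poly iota Q).[x] <= t ^+ (size Q).-1 ->
  exists2 b, root Q b & Cp_abs (x - iota b) <= t.
Proof.
move=> Qm sQ t0; have [s Qs] := closed_field_poly_normal Q.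
rewrite (monicP Qm) scale1r in Qs.
have ss : (size Q).-1 = size s by rewrite Qs size_prod_XsubC.
rewrite {1}Qs rmorph_prod horner_prod uabs_prod ss => le_t.
have [/allP far|/allPn[b bs]] := boolP (all (fun b => t < Cp_abs (x - iota b)) s); last first.
  by rewrite -leNgt => xb; exists b => //; rewrite Qs root_prod_XsubC.
suff : t ^+ size s < \prod_(b <- s) Cp_abs (map_poly iota ('X - b%:P)).[x].
  by rewrite ltNge le_t.
have s0 : (0 < size s)%N by rewrite -ss; lia.
elim: s s0 far {Qs le_t ss} => // b s IH _ far; rewrite big_cons.
have tb : t < Cp_abs (map_poly iota ('X - b%:P)).[x].
  by rewrite map_polyXsubC hornerXsubC far ?mem_head.
have [/size0nil->|s0] := posnP (size s); first by rewrite big_nil mulr1 expr1.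
rewrite exprS ltr_pM ?exprn_ge0 ?IH // => j js.
by rewrite far // inE js orbT.
Qed.

(** [P] is approximated by monic [Q j] with algebraic coefficients. Each root of [Q j] has a root of
    [Q j.+1] within [t ^ j], so a chain of such roots is Cauchy, and its limit is a root of [P]. *)
Lemma Cp_monic_root (P : {poly C}) : P \is monic -> (1 < size P)%N -> exists x, root P x.
Proof.
move=> Pm sP; pose n := (size P).-1; have n0 : (0 < n)%N by rewrite /n; lia.
have Pn : size P = n.+1 by rewrite /n prednK // ltnW.
pose B := \big[Num.max/1]_(i < size P) Cp_abs P`_i.
have B1 : 1 <= B by apply: bigmax_ge_id.
have B0 : 0 < B := lt_le_trans ltr01 B1.
have PB i : Cp_abs P`_i <= B.
  have [si|si] := ltnP i (size P); last by rewrite nth_default // uabs0 ltW.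
  by rewrite /B (bigD1 (Ordinal si)) //= le_max lexx.
pose t : R := 2^-1; have t01 : 0 <= t < 1 by rewrite /t; lra.
have t0 : 0 < t by rewrite /t; lra.
(* Coefficient errors [e j] change values on the disc of radius [B], which contains all the roots
   involved, by at most [e j * B ^ n = (t ^ j) ^ n]: exactly the threshold at which [near_root]
   finds a root within [t ^ j]. *)
pose e j := (t ^+ j / B) ^+ n.
have e0 j : 0 < e j by rewrite exprn_gt0 // divr_gt0 // exprn_gt0.
have tX1 j : t ^+ j <= 1 by rewrite exprn_ile1 //; lra.
have e1 j : e j <= 1.
  by rewrite exprn_ile1 ?divr_ge0 ?exprn_ge0 ?(ltW t0) ?(ltW B0) //
    ler_pdivrMr // mul1r (le_trans (tX1 j)).
have eB j : e j * B ^+ n = t ^+ j ^+ n by rewrite -exprMn divfK // gt_eqF.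
have /choice[c cP] : forall ij : nat * nat, exists y, Cp_abs (P`_ij.1 - iota y) < e ij.2.
  by move=> ij; exact: (completion_dense (Cp_completion C) P`_ij.1 (e0 ij.2)).
pose Q j : {poly Qpbar C} := 'X^n + \poly_(i < n) c (i, j).
have Qm j : Q j \is monic.
  by rewrite monicE lead_coefDl ?lead_coefXn // size_polyXn ltnS size_poly.
have sQ j : size (Q j) = n.+1.
  by rewrite /Q size_polyDl ?size_polyXn // ltnS size_poly.
have PQ j i : Cp_abs (P - map_poly iota (Q j))`_i <= e j.
  rewrite coefB coef_map coefD coefXn coef_poly /=; have [lt_in|lt_ni|->] := ltngtP i n.
  - by rewrite add0r ltW // (cP (i, j)).
  - by rewrite add0r rmorph0 subr0 nth_default ?Pn // uabs0 ltW.
  - by rewrite addr0 rmorph1 -[n]/(size P).-1 -lead_coefE (monicP Pm) subrr uabs0 ltW.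
have QB j i : Cp_abs (map_poly iota (Q j))`_i <= B.
  rewrite -(subKr P`_i (_`_i)) -coefB uabsB_le ?PB //.
  by rewrite (le_trans (PQ j i)) // (le_trans (e1 j)).
have rootB j a : root (Q j) a -> Cp_abs (iota a) <= B.
  move=> Qa; apply: (@uabs_monic_root_le _ _ _ _ (map_poly iota (Q j))) => //.
    by rewrite map_monic.
  by rewrite fmorph_root.
have sPQ j : (size (P - map_poly iota (Q j))%R <= n.+1)%N.
  by rewrite (leq_trans (size_polyD _ _)) // size_polyN size_map_poly sQ Pn maxnn.
have valQ j a : Cp_abs a <= B -> Cp_abs (P - map_poly iota (Q j)).[a] <= t ^+ j ^+ n.
  by move=> aB; rewrite -eB uabs_horner_le // ltW.
have step ja : exists b, root (Q ja.1) ja.2 ->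
    root (Q ja.1.+1) b /\ Cp_abs (iota ja.2 - iota b) <= t ^+ ja.1.
  case: ja => j a /=; have [Qa|_] := boolP (root (Q j) a); last by exists a.
  have [||b Qb ab] := @near_root (Q j.+1) (iota a) (t ^+ j) (Qm _) _ (exprn_ge0 _ (ltW t0)) _.
  - by rewrite sQ; lia.
  - rewrite sQ /=.
    (* Since [Q j] vanishes at [a], this value consists of two approximation errors only. *)
    have -> : (map_poly iota (Q j.+1)).[iota a] =
        (P - map_poly iota (Q j)).[iota a] - (P - map_poly iota (Q j.+1)).[iota a].
      by rewrite !hornerD !hornerN [(map_poly _ (Q j)).[_]]horner_map (rootP Qa) rmorph0; ring.
    apply: uabsB_le; first by rewrite valQ // (rootB j).
    rewrite (le_trans (valQ _ _ _)) ?(rootB j) //.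
    rewrite lerXn2r ?nnegrE ?exprn_ge0 ?(ltW t0) // exprS ler_piMl ?exprn_ge0 ?(ltW t0) //.
    by rewrite /t; lra.
  by exists b.
have [f fP] := choice step.
have [a0 Qa0] : exists a, root (Q 0%N) a by apply/closed_rootP; rewrite sQ; lia.
pose al := fix al j := if j is j'.+1 then f (j', al j') else a0.
have Qal j : root (Q j) (al j).
  by elim: j => //= j IH; have [] := fP (j, al j) IH.
have dal j : Cp_abs (iota (al j) - iota (al j.+1)) <= t ^+ j.
  by have [] := fP (j, al j) (Qal j).
have cal j k : (j <= k)%N -> Cp_abs (iota (al j) - iota (al k)) <= t ^+ j.
  move=> /subnKC <-; elim: (k - j)%N => [|i IH].
    by rewrite addn0 subrr uabs0 exprn_ge0 // ltW.
  rewrite addnS; apply: uabs_dist_le IH _; apply: le_trans (dal _) _.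
  by rewrite exprD ler_piMr ?exprn_ge0 // ltW.
have [|x xP] := @completion_complete _ _ _ _ _ _ (Cp_completion C) (fun j => iota (al j)).
  move=> eps eps0; have [K HK] := expr_lt_eventually t01 eps0; exists K => j k Kj Kk.
  apply: (@uabs_dist_lt _ _ _ _ _ (iota (al K)));
    last exact: le_lt_trans (cal _ _ Kk) (HK K (leqnn K)).
  by rewrite uabs_subC; apply: le_lt_trans (cal _ _ Kj) (HK K (leqnn K)).
exists x; apply/rootP/eqP; rewrite -(uabs_eq0 (v := @Cp_abs _ _ C)) eq_le uabs_ge0 andbT.
have xB : Cp_abs x <= B.
  have [N /(_ N (leqnn N)) xN] := xP _ ltr01.
  rewrite -(subKr (iota (al N)) x) uabsB_le ?(rootB N) //.
  by rewrite (le_trans (ltW xN)).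
rewrite leNgt; apply/negP => Px.
(* A Lipschitz constant of [P] on the disc of radius [B]. *)
pose D := B * B ^+ n; have D0 : 0 < D by rewrite mulr_gt0 ?exprn_gt0.
have [N1 xN1] := xP _ (divr_gt0 Px D0).
have [N2 xN2] := expr_lt_eventually t01 Px.
pose N := maxn N1 N2; have := xN1 N (leq_maxl _ _); rewrite ltr_pdivlMr // => xN.
have : Cp_abs P.[x] < Cp_abs P.[x]; last by rewrite ltxx.
rewrite -{1}(subrK P.[iota (al N)] P.[x]); apply: uabsD_lt.
  apply: le_lt_trans xN; rewrite uabs_subC mulrC.
  by apply: uabs_horner_dist; rewrite ?Pn ?(rootB N) // ltW.
have -> : P.[iota (al N)] = (P - map_poly iota (Q N)).[iota (al N)].
  by rewrite hornerD hornerN horner_map (rootP (Qal N)) rmorph0 subr0.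
apply: le_lt_trans (xN2 N (leq_maxr _ _)); apply: le_trans (valQ _ _ _) _; first exact: (rootB N).
by rewrite -[leRHS]expr1 ler_wiXn2l ?exprn_ge0 // ltW.
Qed.

Lemma Cp_poly_split (P : {poly C}) : exists s, P = lead_coef P *: \prod_(z <- s) ('X - z%:P).
Proof.
have [n] := ubnP (size P); elim: n P => // n IH P sP.
have [->|P0] := eqVneq P 0; first by exists [::]; rewrite lead_coef0 scale0r.
have [s1|s1] := leqP (size P) 1.
  by exists [::]; rewrite big_nil {1 2}(size1_polyC s1) lead_coefC -mul_polyC mulr1.
have c0 : lead_coef P != 0 by rewrite lead_coef_eq0.
have [||x Px] := @Cp_monic_root ((lead_coef P)^-1 *: P).
- by rewrite monicE lead_coefZ mulVf.
- by rewrite size_scale ?invr_eq0.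
move: Px; rewrite rootZ ?invr_eq0 // => /factor_theorem[Q PQ].
have Q0 : Q != 0 by apply: contraNneq P0 => Q0; rewrite PQ Q0 mul0r.
have [|s Qs] := IH Q.
  by move: sP; rewrite PQ size_Mmonic ?monicXsubC // size_XsubC addn2.
exists (x :: s); rewrite {1}PQ {1}Qs big_cons mulrC -scalerAr; congr (_ *: _).
by rewrite PQ lead_coef_Mmonic ?monicXsubC.
Qed.

Hypothesis p_prime : prime p.

(** Roots of [p] of high order. This supplies the points near the boundary of the open unit disc
    from which coefficient bounds are read off. *)
Lemma Cp_abs_near1 (t : R) : 0 <= t < 1 -> exists y : C, t < Cp_abs y < 1.
Proof.
move=> t01; have [|n tn] := expr_lt_eventually t01 (_ : 0 < p%:R^-1).
  by rewrite invr_gt0 ltr0n prime_gt0.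
have {tn} := tn _ (leqnSn n).
have [||y /rootP yn] := @Cp_monic_root ('X^(n.+1) - p%:R%:P).
- by rewrite monicE lead_coefDl ?lead_coefXn // size_polyXn size_polyN ltnS
    (leq_trans (size_polyC_leq1 _)).
- by rewrite size_polyDl ?size_polyXn // size_polyN ltnS (leq_trans (size_polyC_leq1 _)).
move: yn; rewrite !hornerE => /eqP; rewrite subr_eq0 => /eqP yn.
rewrite -(Cp_abs_p p_prime C) -yn uabsX => ty.
exists y; apply/andP; split.
  by rewrite -(ltr_pXn2r (ltn0Sn n)) ?nnegrE ?uabs_ge0 //; case/andP: t01.
by rewrite -(@expr_lt1 _ n.+1) ?uabs_ge0 // -uabsX yn Cp_abs_p_lt1.
Qed.

(** In characteristic 0 the split polynomial [X^n - 1] is separable, so it has [n] distinct roots,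
    and a finite group of roots of unity is cyclic. *)
Lemma Cp_prim_root n : (0 < n)%N -> exists z : C, n.-primitive_root z.
Proof.
move=> n0; have [s sE] := Cp_poly_split ('X^n - 1).
have m1 : ('X^n - 1 : {poly C}) \is monic by rewrite -[1]/(1%:P) monicXnsubC.
rewrite (monicP m1) scale1r in sE.
have rs x : (x \in s) = (x ^+ n == 1).
  by rewrite -root_prod_XsubC -sE rootE !hornerE subr_eq0.
have uroot : all n.-unity_root s.
  by apply/allP => x; rewrite rs unity_rootE.
have us : uniq s.
  by rewrite -separable_prod_XsubC -sE separable_Xn_sub_1 // Cp_natr_neq0.
have ss : size s = n.
  by move: (congr1 (size \o val) sE); rewrite /= size_XnsubC // size_prod_XsubC => -[].
have /hasP[z _ zP] : has n.-primitive_root s.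
  by apply: has_prim_root => //; rewrite ss.
by exists z.
Qed.

End CpClosed.

(** * Averages over roots of unity *)

Definition root_avg p R (C : Cp_model p R) (N : nat) (F : C -> C) : C :=
  N%:R^-1 * \sum_(z \in [set z : C | z ^+ N = 1]) F z.

Section RootAverage.
Variables (p : nat) (R : realType) (C : Cp_model p R).
Implicit Types (F G : C -> C) (N : nat) (w z : C).

Lemma root_avgE N F z : (0 < N)%N -> N.-primitive_root z ->
  root_avg N F = N%:R^-1 * \sum_(i < N) F (z ^+ i).
Proof.
move=> N0 zP; rewrite /root_avg; congr (_ * _).
pose s := [seq z ^+ i | i <- index_iota 0 N].
have us : uniq s.
  rewrite map_inj_in_uniq ?iota_uniq // => i j; rewrite !mem_index_iota /= => iN jN.
  by move/eqP; rewrite (eq_prim_root_expr zP) !modn_small // => /eqP.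
have -> : [set z : C | z ^+ N = 1] = [set` s].
  apply/seteqP; split=> y /=.
    move=> yN; apply/mapP.
    have [i ->] := prim_rootP zP yN; exists (val i) => //.
    by rewrite mem_index_iota ltn_ord.
  by move=> /mapP[i _ ->]; rewrite exprAC (prim_expr_order zP) expr1n.
rewrite -fsbig_seq // big_map big_mkord //.
Qed.

Lemma eq_root_avg N F G : (forall z, z ^+ N = 1 -> F z = G z) ->
  root_avg N F = root_avg N G.
Proof. by move=> FG; rewrite /root_avg; congr (_ * _); apply: eq_fsbigr => z /set_mem /FG. Qed.

Lemma root_avgD N F G : (0 < N)%N ->
  root_avg N (fun z => F z + G z) = root_avg N F + root_avg N G.
Proof.
move=> N0; have [z zP] := Cp_prim_root C N0.
by rewrite !(root_avgE _ N0 zP) big_split mulrDr.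
Qed.

Lemma root_avgZ N (c : C) F : (0 < N)%N ->
  root_avg N (fun z => c * F z) = c * root_avg N F.
Proof.
move=> N0; have [z zP] := Cp_prim_root C N0.
by rewrite !(root_avgE _ N0 zP) -mulr_sumr mulrCA.
Qed.

Lemma root_avg_sum N I (s : seq I) (F : I -> C -> C) : (0 < N)%N ->
  root_avg N (fun z => \sum_(i <- s) F i z) = \sum_(i <- s) root_avg N (F i).
Proof.
move=> N0; have [z zP] := Cp_prim_root C N0.
rewrite (root_avgE _ N0 zP) exchange_big mulr_sumr; apply: eq_bigr => i _.
by rewrite (root_avgE _ N0 zP).
Qed.

Lemma root_avgX N j : (0 < N)%N -> root_avg N (fun z : C => z ^+ j) = (N %| j)%:R.
Proof.
move=> N0; have [z zP] := Cp_prim_root C N0.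
have NC : N%:R != 0 :> C by apply: Cp_natr_neq0.
rewrite (root_avgE _ N0 zP) (prim_order_dvd zP); have [zj|zj] := eqVneq (z ^+ j) 1.
  rewrite (eq_bigr (fun=> 1)) => [|i _]; last by rewrite exprAC zj expr1n.
  by rewrite sumr_const card_ord mulVf.
rewrite (eq_bigr (fun i : 'I_N => (z ^+ j) ^+ i)) => [|i _]; last by rewrite exprAC.
have := subrX1 (z ^+ j) N; rewrite exprAC (prim_expr_order zP) expr1n subrr.
by move/esym/eqP; rewrite mulf_eq0 subr_eq0 (negbTE zj) => /eqP ->; rewrite mulr0.
Qed.

Lemma root_avg_poly N (P : {poly C}) : (0 < N)%N ->
  root_avg N (fun z => z * P.[z]) = \sum_(i < size P) P`_i * (N %| i.+1)%:R.
Proof.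
move=> N0; under eq_root_avg => z _.
  rewrite horner_coef mulr_sumr.
  under eq_bigr => i _ do rewrite mulrCA -exprS.
over.
rewrite root_avg_sum //; apply: eq_bigr => i _.
by rewrite root_avgZ // root_avgX.
Qed.

Lemma root_avg_poly_eq0 N (P : {poly C}) : (size P < N)%N ->
  root_avg N (fun z => z * P.[z]) = 0.
Proof.
move=> sN; rewrite root_avg_poly ?(leq_ltn_trans _ sN) //; apply: big1 => i _.
by rewrite gtnNdvd ?mulr0 // (leq_ltn_trans (ltn_ord i)).
Qed.

(** Every monomial averages to 0 or 1, so the division by [N] costs nothing. *)
Lemma root_avg_poly_le N (P : {poly C}) (e : R) : (0 < N)%N -> 0 <= e ->
  (forall i, Cp_abs P`_i <= e) -> Cp_abs (root_avg N (fun z => z * P.[z])) <= e.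
Proof.
move=> N0 e0 Pe; rewrite root_avg_poly //; apply: uabs_sum_le => // i _.
by rewrite uabsM -[e]mulr1 ler_pM ?uabs_ge0 ?uabs_nat_le1.
Qed.

(** As [z ^ N = 1], the factor [1 - w ^ N = z ^ N - w ^ N] is divisible by [z - w]; in the resulting
    sum of [w ^ i * z ^ (N - i)] only [i = 0] survives averaging. *)
Lemma root_avg_pole N w : (0 < N)%N -> w ^+ N != 1 ->
  root_avg N (fun z => z / (z - w)) = (1 - w ^+ N)^-1.
Proof.
move=> N0 wN.
have wN' : 1 - w ^+ N != 0 by rewrite subr_eq0 eq_sym.
under eq_root_avg => z zN.
  have zw : z - w != 0.
    by rewrite subr_eq0; apply: contraNneq wN => <-; apply/eqP.
  have -> : z / (z - w) = (1 - w ^+ N)^-1 * \sum_(i < N) w ^+ i * z ^+ (N - i).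
    apply: (mulfI wN'); rewrite mulVKf // -[X in X - _]zN subrXX mulrC mulrA divfK //.
    rewrite mulr_sumr; apply: eq_bigr => i _; rewrite mulrA -exprS mulrC; congr (_ * _ ^+ _).
    by have := ltn_ord i; lia.
over.
rewrite root_avgZ // root_avg_sum // (bigD1 (Ordinal N0)) //= big1 ?addr0 => [|i i0].
  by rewrite root_avgZ // root_avgX // subn0 dvdnn !mulr1.
have {}i0 : (i : nat) != 0%N := i0.
by rewrite root_avgZ // root_avgX // gtnNdvd ?mulr0 // ?subn_gt0 //; lia.
Qed.

Hypothesis p_prime : prime p.

(** The crude bound, valid for arbitrary [F]. Its loss of [p ^ n] is acceptable only for errors that
    can be made small after [n] is fixed. *)
Lemma root_avg_le n F (e : R) : 0 <= e ->
  (forall z, z ^+ (p ^ n) = 1 -> Cp_abs (F z) <= e) ->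
  Cp_abs (root_avg (p ^ n) F) <= p%:R ^+ n * e.
Proof.
move=> e0 Fe; have N0 : (0 < p ^ n)%N by rewrite expn_gt0 prime_gt0.
have [z zP] := Cp_prim_root C N0.
rewrite (root_avgE _ N0 zP) uabsM uabsV natrX uabsX Cp_abs_p // exprVn invrK.
rewrite ler_wpM2l ?exprn_ge0 ?ler0n //; apply: uabs_sum_le => // i _.
by apply: Fe; rewrite exprAC (prim_expr_order zP) expr1n.
Qed.

Hypothesis p_odd : odd p.

(** By Frobenius, [(z - 1) ^ (p ^ n)] is congruent to [z ^ (p ^ n) - 1 = 0] modulo [p]. *)
Lemma Cp_abs_unity_sub1 n z : z ^+ (p ^ n) = 1 ->
  Cp_abs (z - 1) ^+ (p ^ n) <= p%:R^-1.
Proof.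
move=> zn; have z1 : Cp_abs z <= 1.
  rewrite -(@expr_le1 _ (p ^ n)) ?uabs_ge0 ?expn_gt0 ?prime_gt0 //.
  by rewrite -uabsX zn uabs1.
have := exprB_pX p_prime (Cp_abs_p_lt1 p_prime C) p_odd n z1 (_ : Cp_abs 1 <= 1).
by rewrite uabs1 zn expr1n subrr subr0 -uabsX Cp_abs_p //; apply.
Qed.

Lemma Cp_abs_unity_sub1_lt1 n z : z ^+ (p ^ n) = 1 -> Cp_abs (z - 1) < 1.
Proof.
move/Cp_abs_unity_sub1 => h; rewrite -(@expr_lt1 _ (p ^ n)) ?uabs_ge0 ?expn_gt0 ?prime_gt0 //.
by apply: le_lt_trans h _; rewrite -(Cp_abs_p p_prime C) Cp_abs_p_lt1.
Qed.

(* In the coordinate [x = z - 1], after scaling [Q] to have constant term 1, [Q]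
   is [1 - x r(x)] with [r] of coefficients at most 1. Expanding [1 / Q] as a
   geometric series up to order [n p^n] leaves a remainder that compensates the
   factor [p^n] coming from the division by the number of roots of unity. *)
Lemma root_avg_rational_le n (P Q : {poly C}) (e : R) : 0 <= e ->
  (forall z, Cp_abs (z - 1) < 1 -> ~~ root Q z) ->
  (forall z, Cp_abs (z - 1) < 1 -> Cp_abs (P.[z] / Q.[z]) <= e) ->
  Cp_abs (root_avg (p ^ n) (fun z => z * (P.[z] / Q.[z]))) <= e.
Proof.
move=> e0 Q0 PQe; have N0 : (0 < p ^ n)%N by rewrite expn_gt0 prime_gt0.
pose q := Q \Po ('X + 1%:P).
have qE x : q.[x] = Q.[x + 1] by rewrite horner_comp !hornerE.
have qx0 x : Cp_abs x < 1 -> q.[x] != 0.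
  by move=> x1; rewrite qE; apply: (Q0 (x + 1)); rewrite addrK.
have c0 : q.[0] != 0 by rewrite qx0 // uabs0.
have [s sE] := Cp_poly_split q.
have lq : lead_coef q != 0.
  by apply: contraNneq c0 => lq; rewrite sE lq scale0r horner0.
have s1 z : z \in s -> 1 <= Cp_abs z.
  move=> zs; rewrite leNgt; apply/negP => /qx0; rewrite sE hornerZ mulf_eq0 (negbTE lq) /=.
  by rewrite -[_ == 0]/(root _ _) root_prod_XsubC zs.
have s0 z : z \in s -> z != 0.
  by move=> /s1 z1; rewrite -(uabs_gt0 (v := @Cp_abs _ _ C)) (lt_le_trans ltr01).
(* All roots of [q] lie outside the open unit disc, so each factor has coefficients at most 1 and
   absolute value exactly 1 on that disc. *)
pose q1 := \prod_(z <- s) (1 - z^-1 *: 'X).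
have q1x x : q1.[x] = q.[x] / q.[0].
  have qq y : q.[y] = lead_coef q * (\prod_(z <- s) - z) * q1.[y].
    rewrite {1}sE hornerZ -mulrA; congr (_ * _); rewrite !horner_prod -big_split /=.
    rewrite !big_seq; apply: eq_bigr => z /s0 z0; rewrite !hornerE; field.
    by rewrite z0.
  have q10 : q1.[0] = 1.
    by rewrite horner_prod big1 // => z _; rewrite !hornerE ?mulr0 ?subr0.
  rewrite !qq q10 mulr1 mulrAC divff ?mul1r // mulf_neq0 // prodf_seq_neq0.
  by apply/allP => z zs /=; rewrite oppr_eq0 s0.
have q1le i : Cp_abs q1`_i <= 1.
  rewrite /q1 big_seq; elim/big_rec: _ i => [|z u zs IH] i.
    by rewrite coef1 uabs_nat_le1.
  rewrite -[leRHS]mulr1; apply: uabs_coefM => // j.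
  rewrite coefB coef1 coefZ coefX uabsB_le ?uabs_nat_le1 // uabsM_le1 ?uabs_nat_le1 //.
  by rewrite uabsV invf_le1 ?s1 // uabs_gt0 s0.
have q1abs x : Cp_abs x < 1 -> Cp_abs q1.[x] = 1.
  move=> x1; rewrite horner_prod uabs_prod big_seq big1 // => z zs.
  rewrite !hornerE addrC uabs_dominant ?uabs1 // uabsN uabsM uabsV.
  by rewrite mulrC ltr_pdivrMr ?mul1r ?(lt_le_trans x1 (s1 _ zs)) // uabs_gt0 s0.
pose f := q.[0]^-1 *: (P \Po ('X + 1%:P)).
have fE x : f.[x] / q1.[x] = P.[x + 1] / Q.[x + 1].
  rewrite q1x hornerZ -qE invf_div mulrA; congr (_ / _).
  by rewrite mulrAC mulVf // mul1r horner_comp !hornerE.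
(* Since [|q1| = 1] on the open disc, the bound on [P / Q] is a bound on the polynomial [f], and it
   passes to the coefficients. *)
have fle : forall i, Cp_abs f`_i <= e.
  apply: uabs_coef_le_horner; first exact: Cp_abs_near1.
  move=> x x1; rewrite -[f.[x]](@divfK _ q1.[x]); last first.
    by rewrite -(uabs_eq0 (v := @Cp_abs _ _ C)) q1abs ?oner_eq0.
  by rewrite uabsM q1abs // mulr1 fE PQe // addrK.
have /factor_theorem[r rE] : root (1 - q1) 0.
  by rewrite rootE !hornerE q1x divff // subrr.
rewrite subr0 in rE.
have rle i : Cp_abs r`_i <= 1.
  have -> : r`_i = (1 - q1)`_i.+1 by rewrite rE coefMX.
  by rewrite coefB coef1 sub0r uabsN.
have rXle : forall i, Cp_abs (r * 'X)`_i <= 1.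
  by move=> i; rewrite -rE coefB uabsB_le // coef1 uabs_nat_le1.
pose m := (p ^ n * n)%N; pose S := \sum_(i < m) (r * 'X) ^+ i.
have q1S : q1 * S = 1 - (r * 'X) ^+ m.
  by rewrite -[RHS]opprB subrX1 -mulNr opprB -[in X in _ = X * _]rE subKr.
have Sle i : Cp_abs S`_i <= 1.
  by rewrite coef_sum; apply: uabs_sum_le => // j _; apply: uabs_coefX_le1.
pose g := (f * S) \Po ('X - 1%:P).
have gle i : Cp_abs g`_i <= e.
  apply: uabs_coef_comp => // j; first by rewrite -[e]mulr1 uabs_coefM.
  by rewrite coefB coefX coefC uabsB_le //; case: (j == _) => //; rewrite ?uabs1 ?uabs0.
(* From [q1 S = 1 - (r X) ^ m] one gets [f / q1 = f S + (f / q1) (r X) ^ m]: a polynomial with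
   coefficients bounded by [e], and the remainder [h]. *)
pose h z := z * (f.[z - 1] / q1.[z - 1] * (r.[z - 1] * (z - 1)) ^+ m).
rewrite (@eq_root_avg _ _ (fun z => z * g.[z] + h z)); last first.
  move=> z /Cp_abs_unity_sub1_lt1 z1; rewrite /h -mulrDr; congr (_ * _).
  have := fE (z - 1); rewrite subrK => <-.
  have q10 : q1.[z - 1] != 0 by rewrite -(uabs_eq0 (v := @Cp_abs _ _ C)) q1abs ?oner_eq0.
  have := congr1 (horner^~ (z - 1)) q1S; rewrite /g horner_comp !hornerE => q1Sz.
  set T := (_ * _) ^+ m in q1Sz *; set A := _^-1 * _.
  have -> : S.[z - 1] = (1 - T) / q1.[z - 1] by rewrite -q1Sz mulrAC divff ?mul1r.
  by ring.
rewrite root_avgD //; apply: uabsD_le; first exact: root_avg_poly_le.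
have e' : e = p%:R ^+ n * (e * p%:R^-1 ^+ n).
  by rewrite mulrCA -exprMn divff ?expr1n ?mulr1 // pnatr_eq0 -lt0n prime_gt0.
rewrite e'; apply: root_avg_le => // [|z zn].
  by rewrite mulr_ge0 ?exprn_ge0 ?invr_ge0 ?ler0n.
have z1 := Cp_abs_unity_sub1_lt1 zn.
rewrite /h -[leRHS]mul1r uabsM ler_pM ?uabs_ge0 //.
  by rewrite -(@expr_le1 _ (p ^ n)) ?uabs_ge0 // -uabsX zn uabs1.
rewrite uabsM ler_pM ?uabs_ge0 //.
  by have := fE (z - 1); rewrite subrK => ->; apply: PQe.
rewrite uabsX uabsM exprMn -[leRHS]mul1r ler_pM ?exprn_ge0 ?uabs_ge0 //.
  by rewrite exprn_ile1 ?uabs_ge0 // uabs_horner_le1 // ltW.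
rewrite /m exprM lerXn2r ?nnegrE ?exprn_ge0 ?uabs_ge0 ?invr_ge0 ?ler0n //.
exact: Cp_abs_unity_sub1.
Qed.

End RootAverage.

(** * Averages along an arc *)

Definition arc_avg p R (C : Cp_model p R) (a b : C) (f : C -> C) (N : nat) : C :=
  root_avg N (fun z => let x := a + (b - a) * z in (x - a) * f x).

Section ArcAverage.
Variables (p : nat) (R : realType) (C : Cp_model p R).
Implicit Types (a b d x z : C) (f g : C -> C) (N n : nat).

Lemma arc_averageE a b f (phi : path_seq) k :
  arc_average a b f phi k = arc_avg a b f (p ^ phi k).
Proof. by rewrite /arc_average /arc_avg /root_avg natrX. Qed.

Lemma arc_avgD a b f g N : (0 < N)%N ->
  arc_avg a b (fun x => f x + g x) N = arc_avg a b f N + arc_avg a b g N.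
Proof.
by move=> N0; rewrite -root_avgD //; apply: eq_root_avg => z _ /=; rewrite mulrDr.
Qed.

Lemma arc_avgZ a b c f N : (0 < N)%N ->
  arc_avg a b (fun x => c * f x) N = c * arc_avg a b f N.
Proof.
by move=> N0; rewrite -root_avgZ //; apply: eq_root_avg => z _ /=; rewrite mulrCA.
Qed.

Lemma arc_avgB a b f g N : (0 < N)%N ->
  arc_avg a b (fun x => f x - g x) N = arc_avg a b f N - arc_avg a b g N.
Proof.
move=> N0; rewrite -[in RHS]mulN1r -arc_avgZ // -arc_avgD //.
by apply: eq_root_avg => z _ /=; rewrite mulN1r.
Qed.

(** The factor [x - a] is a multiple of [z], so only powers of [z] with exponents strictly between 0
    and [N] occur. *)
Lemma arc_avg_poly_eq0 a b (P : {poly C}) N : ((size P).+1 < N)%N ->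
  arc_avg a b (horner P) N = 0.
Proof.
move=> PN; have N0 : (0 < N)%N by apply: leq_ltn_trans PN.
pose L := (b - a) *: 'X + a%:P.
have -> : arc_avg a b (horner P) N = root_avg N (fun z => (b - a) * (z * (P \Po L).[z])).
  apply: eq_root_avg => z _ /=.
  have -> : (P \Po L).[z] = P.[a + (b - a) * z] by rewrite horner_comp !hornerE addrC.
  by ring.
have sL : (size L <= 2)%N.
  rewrite (leq_trans (size_polyD _ _)) // geq_max (leq_trans (size_scale_leq _ _)) ?size_polyX //.
  by rewrite (leq_trans (size_polyC_leq1 _)).
rewrite root_avgZ // root_avg_poly_eq0 ?mulr0 // (leq_ltn_trans (size_comp_poly_leq _ _)) //.
apply: leq_ltn_trans PN; rewrite ltnS (leq_trans _ (leq_pred (size P))) //.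
by rewrite -[leqRHS]muln1 leq_mul2l; apply/orP; right; lia.
Qed.

Lemma arc_avg_pole a b d N : (0 < N)%N -> a != b -> ((d - a) / (b - a)) ^+ N != 1 ->
  arc_avg a b (fun x => (x - d)^-1) N = (1 - ((d - a) / (b - a)) ^+ N)^-1.
Proof.
move=> N0 ab wN; have ba0 : b - a != 0 by rewrite subr_eq0 eq_sym.
rewrite -root_avg_pole //; apply: eq_root_avg => z zN /=.
have zw : z - (d - a) / (b - a) != 0.
  by rewrite subr_eq0; apply: contraNneq wN => <-; rewrite zN.
have -> : a + (b - a) * z - d = (b - a) * (z - (d - a) / (b - a)) by field.
have -> : a + (b - a) * z - a = (b - a) * z by ring.
by rewrite invfM mulrACA divff // mul1r.
Qed.

Hypothesis (p_prime : prime p) (p_odd : odd p).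

(** Roots of unity of [p]-power order lie in the open unit disc around 1; hence the averages see [f]
    only on the arc. *)
Lemma disc_arc_unity a b z n : z ^+ (p ^ n) = 1 -> a != b ->
  disc_arc a b (a + (b - a) * z).
Proof.
move=> zn ab; rewrite /disc_arc /open_disc /=.
have -> : a + (b - a) * z - b = (b - a) * (z - 1) by ring.
rewrite uabsM uabs_subC gtr_pMr ?uabs_gt0 ?subr_eq0 //.
exact: Cp_abs_unity_sub1_lt1 zn.
Qed.

Lemma eq_arc_avg a b f g n : a != b -> (forall x, disc_arc a b x -> f x = g x) ->
  arc_avg a b f (p ^ n) = arc_avg a b g (p ^ n).
Proof.
by move=> ab fg; apply: eq_root_avg => z zn /=; rewrite fg //; apply: disc_arc_unity zn ab.
Qed.

Lemma arc_avg_le a b f n (e : R) : a != b -> 0 <= e ->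
  (forall x, disc_arc a b x -> Cp_abs (f x) <= e) ->
  Cp_abs (arc_avg a b f (p ^ n)) <= p%:R ^+ n * (Cp_abs (a - b) * e).
Proof.
move=> ab e0 fe; apply: root_avg_le => // [|z zn]; first by rewrite mulr_ge0 ?uabs_ge0.
have /fe h := disc_arc_unity zn ab.
rewrite /= [a + _ - a]addrC addKr !uabsM (uabs_subC a) -mulrA ler_wpM2l ?uabs_ge0 //.
rewrite -[leRHS]mul1r ler_pM ?uabs_ge0 //.
by rewrite -(@expr_le1 _ (p ^ n)) ?uabs_ge0 ?expn_gt0 ?prime_gt0 // -uabsX zn uabs1.
Qed.

Lemma arc_avg_rational_le a b (P Q : {poly C}) n (e : R) : a != b -> 0 <= e ->
  (forall x, disc_arc a b x -> ~~ root Q x) ->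
  (forall x, disc_arc a b x -> Cp_abs (P.[x] / Q.[x]) <= e) ->
  Cp_abs (arc_avg a b (fun x => P.[x] / Q.[x]) (p ^ n)) <= Cp_abs (a - b) * e.
Proof.
move=> ab e0 Q0 PQe; have N0 : (0 < p ^ n)%N by rewrite expn_gt0 prime_gt0.
pose L := (b - a) *: 'X + a%:P.
have compL (T : {poly C}) z : (T \Po L).[z] = T.[a + (b - a) * z].
  by rewrite horner_comp !hornerE addrC.
have arcL z : Cp_abs (z - 1) < 1 -> disc_arc a b (a + (b - a) * z).
  move=> z1; rewrite /disc_arc /open_disc /=.
  have -> : a + (b - a) * z - b = (b - a) * (z - 1) by ring.
  by rewrite uabsM uabs_subC gtr_pMr ?uabs_gt0 ?subr_eq0.
have -> : arc_avg a b (fun x => P.[x] / Q.[x]) (p ^ n) =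
    root_avg (p ^ n) (fun z => (b - a) * (z * ((P \Po L).[z] / (Q \Po L).[z]))).
  by apply: eq_root_avg => z _ /=; rewrite !compL mulrA; congr (_ * _); ring.
rewrite root_avgZ // uabsM uabs_subC ler_wpM2l ?uabs_ge0 //.
apply: root_avg_rational_le => // z /arcL xz; last by rewrite !compL PQe.
by rewrite rootE compL; apply: Q0.
Qed.

End ArcAverage.

(** * From simple poles to Krasner analytic functions *)

Section ArcFamily.
Variables (p : nat) (R : realType) (C : Cp_model p R).
Hypothesis (p_prime : prime p) (p_odd : odd p).
Variables (I : finType) (ctr pt nu : I -> C) (phi : nat -> nat).
Hypothesis ctr_pt : forall i, ctr i != pt i.
Hypothesis phi_ge : forall k, (k <= phi k)%N.
Implicit Types (d x : C) (f g : C -> C).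

Let A f i k := arc_avg (ctr i) (pt i) f (p ^ phi k).

Let N0 k : (0 < p ^ phi k)%N. Proof. by rewrite expn_gt0 prime_gt0. Qed.

(** Existence of all the integrals together with the linear relation between them, phrased as a
    Cauchy condition. No limits are named, which makes stability under linear combinations and
    approximation direct. *)
Definition averages_settle f : Prop := forall e : R, 0 < e -> exists K, forall k l,
  (K <= k)%N -> (K <= l)%N ->
  (forall i, Cp_abs (A f i k - A f i l) < e) /\ Cp_abs (\sum_i nu i * A f i k) < e.

Lemma averages_settle_ext f g :
  (forall i x, disc_arc (ctr i) (pt i) x -> f x = g x) ->
  averages_settle f -> averages_settle g.
Proof.
move=> fg; have Afg i k : A g i k = A f i k.
  by apply: eq_arc_avg => // x /fg.
move=> sf e /sf[K HK]; exists K => k l Kk Kl; have [h1 h2] := HK k l Kk Kl.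
split=> [i|]; first by rewrite !Afg.
by under eq_bigr => i _ do rewrite Afg.
Qed.

Lemma averages_settleD f g : averages_settle f -> averages_settle g ->
  averages_settle (fun x => f x + g x).
Proof.
move=> sf sg e e0; have [[K HK] [L HL]] := (sf e e0, sg e e0).
exists (maxn K L) => k l; rewrite !geq_max => /andP[Kk Lk] /andP[Kl Ll].
have [[f1 f2] [g1 g2]] := (HK k l Kk Kl, HL k l Lk Ll); split=> [i|].
  rewrite /A !arc_avgD //.
  have := uabsD_lt (f1 i) (g1 i); rewrite /A opprD addrACA; exact.
under eq_bigr => i _ do rewrite /A arc_avgD // mulrDr.
by rewrite big_split; apply: uabsD_lt.
Qed.

Lemma averages_settleZ c f : averages_settle f -> averages_settle (fun x => c * f x).
Proof.
move=> sf e e0; have [c0|c0] := eqVneq c 0.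
  exists 0%N => k l _ _; split=> [i|].
    by rewrite /A !arc_avgZ // c0 !mul0r subrr uabs0.
  rewrite big1 ?uabs0 // => i _; by rewrite /A arc_avgZ // c0 mul0r mulr0.
have vc : 0 < Cp_abs c by rewrite uabs_gt0.
have [K HK] := sf _ (divr_gt0 e0 vc); exists K => k l Kk Kl.
have [h1 h2] := HK k l Kk Kl; split=> [i|].
  by rewrite /A !arc_avgZ // -mulrBr uabsM mulrC -ltr_pdivlMr //; apply: h1.
under eq_bigr => i _ do rewrite /A arc_avgZ // mulrCA.
by rewrite -mulr_sumr uabsM mulrC -ltr_pdivlMr.
Qed.

(** Closeness is required of the averages, uniformly in [k], not of the functions. The weights
    enlarge the error by at most [V], whence the tolerance [e / 2 / V]. *)
Lemma averages_settle_limit f :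
  (forall e : R, 0 < e -> exists2 g, averages_settle g &
     forall i k, Cp_abs (A f i k - A g i k) <= e) ->
  averages_settle f.
Proof.
move=> fg e e0; pose V := \big[Num.max/1]_i Cp_abs (nu i).
have V1 : 1 <= V by apply: bigmax_ge_id.
have V0 : 0 < V := lt_le_trans ltr01 V1.
have d0 : 0 < e / 2 / V by rewrite !divr_gt0.
have de : e / 2 / V < e.
  rewrite ltr_pdivrMr // (@lt_le_trans _ _ e) //; first by lra.
  by rewrite ler_peMr // ltW.
have [g sg fgA] := fg _ d0; have [K HK] := sg e e0.
exists K => k l Kk Kl; have [g1 g2] := HK k l Kk Kl; split=> [i|].
  apply: uabs_dist_lt (le_lt_trans (fgA i k) de) _.
  by apply: uabs_dist_lt (g1 i) _; rewrite uabs_subC (le_lt_trans (fgA i l)).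
rewrite (eq_bigr (fun i => nu i * (A f i k - A g i k) + nu i * A g i k)); last first.
  by move=> i _; rewrite -mulrDr subrK.
rewrite big_split; apply: uabsD_lt g2; apply: uabs_sum_lt => // i _.
rewrite uabsM (@le_lt_trans _ _ (V * (e / 2 / V))) //.
  by rewrite ler_pM ?uabs_ge0 // /V (bigD1 i) //= le_max lexx.
by rewrite mulrC divfK ?gt_eqF //; lra.
Qed.

Lemma averages_settle_poly (P : {poly C}) : averages_settle (horner P).
Proof.
move=> e e0; exists (size P).+2; have A0 i k : ((size P).+2 <= k)%N -> A (horner P) i k = 0.
  move=> sk; rewrite /A arc_avg_poly_eq0 //; apply: leq_trans sk _.
  by rewrite (leq_trans (phi_ge k)) // ltnW // ltn_expl // prime_gt1.
move=> k l sk sl; split=> [i|]; first by rewrite !A0 // subrr uabs0.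
by rewrite big1 ?uabs0 // => i _; rewrite A0 ?mulr0.
Qed.

Lemma averages_settleP f : averages_settle f <->
  exists2 L : I -> C,
    forall i (e : R), 0 < e -> exists K, forall k, (K <= k)%N -> Cp_abs (A f i k - L i) < e
  & \sum_i nu i * L i = 0.
Proof.
have common (Q : I -> nat -> Prop) : (forall i, exists K, forall k, (K <= k)%N -> Q i k) ->
    exists K, forall i k, (K <= k)%N -> Q i k.
  move=> /choice[K KP]; exists (\max_i K i) => i k Kk; apply: KP.
  exact: leq_trans (leq_bigmax i) Kk.
have sum_lt (u : I -> C) (e : R) : 0 < e ->
    (forall i, Cp_abs (u i) < e / \big[Num.max/1]_j Cp_abs (nu j)) ->
    Cp_abs (\sum_i nu i * u i) < e.
  set V := \big[_/_]_j _ => e0 ue.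
  have V0 : 0 < V by apply: lt_le_trans ltr01 _; apply: bigmax_ge_id.
  apply: uabs_sum_lt => // i _; rewrite uabsM (@le_lt_trans _ _ (V * Cp_abs (u i))) //.
    by rewrite ler_wpM2r ?uabs_ge0 // /V (bigD1 i) //= le_max lexx.
  by rewrite mulrC -ltr_pdivlMr.
have V0 : 0 < \big[Num.max/1]_j Cp_abs (nu j).
  by apply: lt_le_trans ltr01 _; apply: bigmax_ge_id.
split=> [sf|[L AL nuL] e e0].
  have /choice[L AL] : forall i, exists l, forall e : R, 0 < e ->
      exists K, forall k, (K <= k)%N -> Cp_abs (A f i k - l) < e.
    move=> i; have [|l lP] :=
      @completion_complete _ _ _ _ _ _ (Cp_completion C) (A f i); last by exists l.
    by move=> e /sf[K HK]; exists K => j k Kj Kk; case: (HK j k Kj Kk).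
  exists L => //; apply/eqP; rewrite -(uabs_eq0 (v := @Cp_abs _ _ C)) eq_le uabs_ge0 andbT.
  rewrite leNgt; apply/negP; set e := Cp_abs _ => e0.
  have [K HK] := sf _ e0.
  have [K' HK'] := common _ (fun i => AL i _ (divr_gt0 e0 V0)).
  pose k := maxn K K'; have [_ sk] := HK k k (leq_maxl _ _) (leq_maxl _ _).
  have : e < e; last by rewrite ltxx.
  have /(sum_lt _ _ e0) : forall i, Cp_abs (L i - A f i k) < e / \big[Num.max/1]_j Cp_abs (nu j).
    by move=> i; rewrite uabs_subC HK' ?leq_maxr.
  under eq_bigr => i _ do rewrite mulrBr.
  rewrite sumrB => /uabsD_lt/(_ sk); rewrite subrK; exact.
have d0 : 0 < Num.min e (e / \big[Num.max/1]_j Cp_abs (nu j)) by rewrite lt_min e0 divr_gt0.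
have [K HK] := common _ (fun i => AL i _ d0).
exists K => k l Kk Kl; split=> [i|].
  have := HK i k Kk; have := HK i l Kl; rewrite !lt_min => /andP[il _] /andP[ik _].
  by apply: uabs_dist_lt ik _; rewrite uabs_subC.
have /(sum_lt _ _ e0) : forall i, Cp_abs (A f i k - L i) < e / \big[Num.max/1]_j Cp_abs (nu j).
  by move=> i; have := HK i k Kk; rewrite lt_min => /andP[].
by under eq_bigr => i _ do rewrite mulrBr; rewrite sumrB nuL subr0.
Qed.

(** [E] is the set of admissible poles, later the complement of the domain. Poles keep at least the
    radius away from every arc; openness leaves room to move a repeated pole. *)
Variable E : set C.
Hypothesis E_arc : forall d i x, E d -> disc_arc (ctr i) (pt i) x ->
  Cp_abs (ctr i - pt i) <= Cp_abs (x - d).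
Hypothesis E_open : forall d, E d ->
  exists2 e : R, 0 < e & forall d', Cp_abs (d' - d) < e -> E d'.
Hypothesis E_pole : forall d, E d -> averages_settle (fun x => (x - d)^-1).

Let den (s : seq C) : {poly C} := \prod_(z <- s) ('X - z%:P).

Let rad_gt0 i : 0 < Cp_abs (ctr i - pt i).
Proof. by rewrite uabs_gt0 subr_eq0. Qed.

Let E_neq d i x : E d -> disc_arc (ctr i) (pt i) x -> x - d != 0.
Proof.
by move=> Ed xi; rewrite -(uabs_gt0 (v := @Cp_abs _ _ C)) (lt_le_trans (rad_gt0 i)) ?E_arc.
Qed.

Let den_neq0 s i x : (forall z, z \in s -> E z) -> disc_arc (ctr i) (pt i) x ->
  (den s).[x] != 0.
Proof.
move=> sE xi; rewrite horner_prod prodf_seq_neq0; apply/allP => z zs /=.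
by rewrite hornerXsubC (E_neq (sE z zs) xi).
Qed.

Let rational_bounded s (P : {poly C}) i : (forall z, z \in s -> E z) ->
  exists2 K : R, 0 <= K &
    forall x, disc_arc (ctr i) (pt i) x -> Cp_abs (P.[x] / (den s).[x]) <= K.
Proof.
move=> sE; pose r := Cp_abs (ctr i - pt i).
have r0 : 0 < r by apply: rad_gt0.
pose B := Num.max 1 (Num.max r (Cp_abs (pt i))).
have B1 : 1 <= B by rewrite le_max lexx.
pose c := \big[Num.max/0]_(j < size P) Cp_abs P`_j.
have c0 : 0 <= c by apply: bigmax_ge_id.
have Pc j : Cp_abs P`_j <= c.
  have [sj|sj] := ltnP j (size P); last by rewrite nth_default // uabs0.
  by rewrite /c (bigD1 (Ordinal sj)) //= le_max lexx.
exists (c * B ^+ (size P).-1 / r ^+ size s).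
  by rewrite divr_ge0 ?mulr_ge0 ?exprn_ge0 ?(ltW r0) // (le_trans ler01).
move=> x xi; rewrite uabs_div ler_pM ?invr_ge0 ?uabs_ge0 //.
  apply: uabs_horner_le => //; first exact: leqSpred.
  rewrite -(subrK (pt i) x); apply: uabsD_le; last by rewrite !le_max lexx !orbT.
  by rewrite !le_max (ltW xi) !orbT.
have d0 : 0 < Cp_abs (den s).[x] by rewrite uabs_gt0 (den_neq0 sE xi).
rewrite lef_pV2 ?posrE ?exprn_gt0 // /den horner_prod uabs_prod {d0}.
elim: s sE => [|z s IH] sE; first by rewrite big_nil.
rewrite big_cons exprS ler_pM ?exprn_ge0 ?(ltW r0) //.
  by rewrite hornerXsubC; apply: E_arc xi; apply: sE; apply: mem_head.
by apply: IH => y ys; apply: sE; rewrite inE ys orbT.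
Qed.

(** Induction on the number of poles. Two distinct leading poles are separated by [1 / ((x - d) (x -
    d')) = (1 / (x - d) - 1 / (x - d')) / (d - d')]. If they coincide, one is shifted to a nearby
    [d'] and the averages are compared. *)
Lemma averages_settle_rational (P : {poly C}) s : (forall z, z \in s -> E z) ->
  averages_settle (fun x => P.[x] / (\prod_(z <- s) ('X - z%:P)).[x]).
Proof.
have [n] := ubnP (size s); elim: n s => // n IH [|d [|e s]] /=; rewrite ltnS => sn sE.
- apply: averages_settle_ext (averages_settle_poly P) => i x _.
  by rewrite big_nil hornerE divr1.
- have Ed : E d by apply: sE; apply: mem_head.
  have /factor_theorem[Q QE] : root (P - P.[d]%:P) d by rewrite rootE !hornerE subrr.
  apply: averages_settle_ext (averages_settleD (averages_settle_poly Q)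
    (averages_settleZ P.[d] (E_pole Ed))) => i x xi.
  have xd := E_neq Ed xi; rewrite big_seq1 hornerXsubC.
  have -> : P.[x] = Q.[x] * (x - d) + P.[d].
    by have := congr1 (horner^~ x) QE; rewrite !hornerE => <-; rewrite subrK.
  by rewrite mulrDl mulfK.
have Ed : E d by apply: sE; apply: mem_head.
have Es z : z \in s -> E z by move=> zs; apply: sE; rewrite !inE zs !orbT.
have distinct d' : E d' -> d != d' ->
    averages_settle (fun x => P.[x] / (den [:: d, d' & s]).[x]).
  move=> Ed' dd'.
  have IHd y : E y -> averages_settle (fun x => P.[x] / (den (y :: s)).[x]).
    by move=> Ey; apply: IH => // z; rewrite inE => /predU1P[->|/Es].
  apply: averages_settle_ext (averages_settleZ (d - d')^-1 (averages_settleD (IHd d Ed)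
    (averages_settleZ (-1) (IHd d' Ed')))) => i x xi.
  have [xd xd' xs] := And3 (E_neq Ed xi) (E_neq Ed' xi) (den_neq0 Es xi).
  rewrite /den !big_cons !hornerM !hornerXsubC -/(den s).
  by field; rewrite xs xd xd' subr_eq0 dd'.
have Ee : E e by apply: sE; rewrite inE mem_head orbT.
have [de|] := eqVneq d e; last exact: distinct.
rewrite -{e Ee}de in sn sE *.
apply: averages_settle_limit => eps eps0.
have /choice[K KP] : forall i, exists K : R, 0 <= K /\ forall x, disc_arc (ctr i) (pt i) x ->
    Cp_abs (P.[x] / (den [:: d, d & s]).[x]) <= K.
  by move=> i; have [K K0 KP] := @rational_bounded [:: d, d & s] P i sE; exists K.
pose M := \big[Num.max/1]_i K i.
have M0 : 0 < M by apply: lt_le_trans ltr01 _; apply: bigmax_ge_id.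
have [del del0 Edel] := E_open Ed.
have [d' [d'd' dd' d'M]] : exists d',
    [/\ d != d', Cp_abs (d' - d) < del & Cp_abs (d' - d) * M <= eps].
  have pn1 : 0 <= Cp_abs (p%:R : C) < 1 by rewrite uabs_ge0 Cp_abs_p_lt1.
  have e'0 : 0 < Num.min del (eps / M) by rewrite lt_min del0 divr_gt0.
  have [k /(_ k (leqnn k))] := expr_lt_eventually pn1 e'0.
  rewrite -uabsX lt_min => /andP[pd pM]; exists (d + p%:R ^+ k); split.
  - rewrite -subr_eq0 opprD addNKr oppr_eq0 expf_neq0 //.
    by apply: Cp_natr_neq0; apply: prime_gt0.
  - by rewrite [d + _]addrC addrK.
  - by rewrite [d + _]addrC addrK ltW // -ltr_pdivlMr.
have Ed' := Edel _ dd'.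
exists (fun x => P.[x] / (den [:: d, d' & s]).[x]); first exact: distinct.
move=> i k; have [K0 KPi] := KP i; set r := Cp_abs (ctr i - pt i).
have r0 : 0 < r by apply: rad_gt0.
rewrite /A -arc_avgB //.
(* The difference of the two functions is [(d - d') P] over the denominator with both [d] doubled
   and [d'] present. *)
pose s3 := [:: d, d, d' & s].
have s3E z : z \in s3 -> E z by rewrite !inE => /or4P[/eqP->|/eqP->|/eqP->|/Es].
rewrite (@eq_arc_avg _ _ _ p_prime p_odd _ _ _
    (fun x => ((d - d') *: P).[x] / (den s3).[x])) //; last first.
  move=> x xi; have [xd xd' xs] := And3 (E_neq Ed xi) (E_neq Ed' xi) (den_neq0 Es xi).
  rewrite /den !big_cons !hornerM !hornerXsubC -/(den s) hornerZ.
  by field; rewrite xs xd xd'.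
(* The radius [r] from the bound on averages cancels against [1 / |x - d'| <= 1 / r]. *)
apply: le_trans (_ : r * (Cp_abs (d' - d) * K i / r) <= _); last first.
  rewrite mulrC divfK ?gt_eqF // (le_trans _ d'M) // ler_wpM2l ?uabs_ge0 //.
  by rewrite /M (bigD1 i) //= le_max lexx.
apply: arc_avg_rational_le => // [|x xi|x xi].
- by rewrite !mulr_ge0 ?invr_ge0 ?uabs_ge0.
- exact: den_neq0 xi.
have [xd xd' xs] := And3 (E_neq Ed xi) (E_neq Ed' xi) (den_neq0 Es xi).
have -> : ((d - d') *: P).[x] / (den s3).[x] =
    (d - d') * (P.[x] / (den [:: d, d & s]).[x]) / (x - d').
  rewrite /den !big_cons !hornerM !hornerXsubC -/(den s) hornerZ.
  by field; rewrite xs xd xd'.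
rewrite uabs_div uabsM uabs_subC ler_pM ?invr_ge0 ?mulr_ge0 ?uabs_ge0 //.
  by rewrite ler_wpM2l ?uabs_ge0 ?KPi.
have rx : r <= Cp_abs (x - d') by apply: E_arc xi.
by rewrite lef_pV2 ?posrE // (lt_le_trans r0 rx).
Qed.

Lemma averages_settle_krasner (D : set C) f : E = ~` D ->
  (forall i, disc_arc (ctr i) (pt i) `<=` D) -> krasner_analytic D f ->
  averages_settle f.
Proof.
move=> ED arcD [g [g_rat g_lim]].
have arc_pole (Q : {poly C}) i x : (forall x, root Q x -> ~ D x) ->
    disc_arc (ctr i) (pt i) x -> ~~ root Q x.
  by move=> QD xi; apply/negP => /QD; apply; apply: arcD xi.
have settle_g n : averages_settle (g n).
  have [P [Q [Q0 _ QD gE]]] := g_rat n.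
  have [s Qs] := Cp_poly_split Q.
  have lQ : lead_coef Q != 0 by rewrite lead_coef_eq0.
  have sE z : z \in s -> E z.
    by move=> zs; rewrite ED; apply: QD; rewrite Qs rootZ // root_prod_XsubC.
  apply: averages_settle_ext (averages_settle_rational ((lead_coef Q)^-1 *: P) sE) => i x xi.
  rewrite gE; last exact: arcD xi.
  by rewrite [in RHS]Qs !hornerZ invfM [RHS]mulrA [P.[x] * _]mulrC.
apply: averages_settle_limit => e e0.
pose M := \big[Num.max/1]_i Cp_abs (ctr i - pt i).
have M0 : 0 < M by apply: lt_le_trans ltr01 _; apply: bigmax_ge_id.
have rM i : Cp_abs (ctr i - pt i) <= M by rewrite /M (bigD1 i) //= le_max lexx.
have [n0 Hn0] := g_lim _ (divr_gt0 e0 M0).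
exists (g n0) => // i k; set r := Cp_abs (ctr i - pt i).
have r0 : 0 < r by apply: rad_gt0.
have pk0 : 0 < p%:R ^+ phi k :> R by rewrite exprn_gt0 // ltr0n prime_gt0.
(* The sharp bound is available for rational functions only. So [f] is first replaced by [g m], with
   [m] depending on [i] and [k] and so large that the crude bound suffices; the sharp bound then
   compares [g m] with [g n0], uniformly in [k]. *)
have [n1 Hn1] := g_lim _ (divr_gt0 e0 (mulr_gt0 pk0 r0)).
pose m := maxn n0 n1.
have -> : A f i k - A (g n0) i k = (A f i k - A (g m) i k) + (A (g m) i k - A (g n0) i k).
  by rewrite addrA subrK.
apply: uabsD_le.
  rewrite /A -arc_avgB //.
  apply: le_trans (arc_avg_le (e := e / (p%:R ^+ phi k * r)) p_prime p_odd _ _ _ _) _ => //.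
  - by rewrite divr_ge0 ?ltW // mulr_gt0.
  - move=> x xi; rewrite uabs_subC ltW // Hn1 ?leq_maxr //; exact: arcD xi.
  - by rewrite -/r mulrA mulrC divfK // mulf_neq0 ?gt_eqF.
have [Pm [Qm [Qm0 _ QmD gmE]]] := g_rat m.
have [Pn [Qn [Qn0 _ QnD gnE]]] := g_rat n0.
rewrite /A -arc_avgB // (@eq_arc_avg _ _ _ p_prime p_odd _ _ _
    (fun x => (Pm * Qn - Pn * Qm).[x] / (Qm * Qn).[x])) //; last first.
  move=> x xi; rewrite gmE ?gnE; [|exact: arcD xi..].
  have [xm xn] := (arc_pole _ _ _ QmD xi, arc_pole _ _ _ QnD xi).
  rewrite !hornerE; field; by rewrite -!rootE xm xn.
apply: le_trans (_ : r * (e / M) <= _); last first.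
  by rewrite mulrC mulrAC ler_pdivrMr // ler_wpM2l ?rM ?(ltW e0).
apply: arc_avg_rational_le => // [|x xi|x xi].
- by rewrite divr_ge0 // ltW.
- by rewrite rootM negb_or (arc_pole _ _ _ QmD xi) (arc_pole _ _ _ QnD xi).
have -> : (Pm * Qn - Pn * Qm).[x] / (Qm * Qn).[x] = g m x - g n0 x.
  rewrite gmE ?gnE; [|exact: arcD xi..].
  have [xm xn] := (arc_pole _ _ _ QmD xi, arc_pole _ _ _ QnD xi).
  rewrite !hornerE; field; by rewrite -!rootE xm xn.
have Dx := arcD _ _ xi; apply: (@uabs_dist_le _ _ _ _ _ (f x)).
  by rewrite ltW // Hn0 // leq_maxl.
by rewrite uabs_subC ltW // Hn0.
Qed.

End ArcFamily.

(** * Teichmuller representatives *)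

(** Being fixed by a power of Frobenius means being 0 or a root of unity of order prime to [p]. *)
Definition teichmuller_reps p R (C : Cp_model p R) (w : C) : set C :=
  [set t | Cp_abs (t - w) < 1 /\ exists2 s, (0 < s)%N & t ^+ (p ^ s) = t].

Definition teichmuller p R (C : Cp_model p R) (w : C) : C := xget 0 (teichmuller_reps w).

(* The limit of [1 / (1 - w ^ (p ^ (alpha + s k)))] as [k] grows, for suitable [s]. *)
Definition pole_value p R (C : Cp_model p R) (alpha : nat) (w : C) : C :=
  if Cp_abs w <= 1 then (1 - teichmuller w ^+ (p ^ alpha))^-1 else 0.

Section Teichmuller.
Variables (p : nat) (R : realType) (C : Cp_model p R).
Hypothesis (p_prime : prime p) (p_odd : odd p).
Implicit Types (w t u : C).

Let vp1 := Cp_abs_p_lt1 p_prime C.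

(** Since [w ^ (p ^ s)] is congruent to [w], contraction under Frobenius makes the iterates
    [w ^ (p ^ (s k))] a Cauchy sequence; its limit is fixed by the [p ^ s]-th power. *)
Lemma teichmuller_exists w : Cp_abs w <= 1 -> teichmuller_reps w !=set0.
Proof.
move=> w1; have [s s0 ws] := Cp_residue_algebraic p_prime p_odd w1.
have ws1 : Cp_abs (w ^+ (p ^ s)) <= 1 by rewrite uabsX_le1.
pose u k := w ^+ (p ^ (s * k)).
have uS k : u k.+1 = w ^+ (p ^ s) ^+ (p ^ (s * k)) by rewrite /u -exprM -expnD mulnS.
have uSk k : u k.+1 = u k ^+ (p ^ s) by rewrite /u -exprM -expnD addnC -mulnS.
have u1 k : Cp_abs (u k) <= 1 by rewrite uabsX_le1.
have [|t ut] := @completion_complete _ _ _ _ _ _ (Cp_completion C) u.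
  move=> e e0; have [K HK] := expr_pX_dist_null p_prime vp1 ws1 w1 ws e0.
  have step k i : (K <= k)%N -> Cp_abs (u (k + i)%N - u k) < e.
    move=> Kk; elim: i => [|i IH]; first by rewrite addn0 subrr uabs0.
    rewrite addnS; apply: uabs_dist_lt IH; rewrite uS HK //.
    by rewrite (leq_trans Kk) // (leq_trans (leq_addr i k)) // leq_pmull.
  exists K => j k Kj Kk; apply: (@uabs_dist_lt _ _ _ _ _ (u K)).
    by rewrite -(subnKC Kj) step.
  by rewrite -(subnKC Kk) uabs_subC step.
have t1 : Cp_abs t <= 1.
  have [K /(_ K (leqnn K)) uK] := ut _ ltr01.
  by rewrite -(subKr (u K) t) uabsB_le // ltW.
exists t; split.
  have [K /(_ K (leqnn K)) uK] := ut _ ltr01.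
  rewrite uabs_subC; apply: uabs_dist_lt uK; rewrite uabs_subC.
  elim: (K) => [|k IH]; first by rewrite /u muln0 expn0 expr1 subrr uabs0.
  apply: uabs_dist_lt IH; rewrite uS; apply: le_lt_trans ws.
  exact: expr_pX_dist_le.
exists s => //; apply/eqP; rewrite -subr_eq0 -(uabs_eq0 (v := @Cp_abs _ _ C)).
rewrite eq_le uabs_ge0 andbT leNgt; apply/negP => e0.
have [K HK] := ut _ e0; have := HK K.+1 (leqnSn K); rewrite uSk => uK1.
have : Cp_abs (t ^+ (p ^ s) - t) < Cp_abs (t ^+ (p ^ s) - t); last by rewrite ltxx.
apply: uabs_dist_lt uK1; rewrite uabs_subC; apply: le_lt_trans (HK K (leqnn K)).
exact: expr_pX_dist_le.
Qed.

(** A common power of Frobenius fixes both elements, yet its iterates shrink their distance to 0. *)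
Lemma teichmuller_unique w t u :
  Cp_abs w <= 1 -> teichmuller_reps w t -> teichmuller_reps w u -> t = u.
Proof.
move=> w1 [tw [s s0 ts]] [uw [r r0 ur]].
have near1 y : Cp_abs (y - w) < 1 -> Cp_abs y <= 1.
  by move=> yw; rewrite -(subrK w y) uabsD_le // ltW.
have iter y l n : y ^+ (p ^ l) = y -> y ^+ (p ^ (l * n)) = y :> C.
  by move=> yl; elim: n => [|n IH]; rewrite ?muln0 ?expr1 // mulnS expnD exprM yl.
apply/eqP; rewrite -subr_eq0 -(uabs_eq0 (v := @Cp_abs _ _ C)).
rewrite eq_le uabs_ge0 andbT leNgt; apply/negP => e0.
have tu : Cp_abs (t - u) < 1 by apply: uabs_dist_lt tw _; rewrite uabs_subC.
have [K HK] := expr_pX_dist_null p_prime vp1 (near1 _ tw) (near1 _ uw) tu e0.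
have tn : t ^+ (p ^ (s * r * K)) = t by rewrite -mulnA iter.
have un : u ^+ (p ^ (s * r * K)) = u by rewrite (mulnC s) -mulnA iter.
have := HK (s * r * K)%N; rewrite tn un ltxx => /(_ _)/notF; apply.
by rewrite leq_pmull // muln_gt0 s0.
Qed.

Lemma teichmullerP w : Cp_abs w <= 1 -> teichmuller_reps w (teichmuller w).
Proof. by move/teichmuller_exists => [t]; apply: xgetI. Qed.

Lemma eq_teichmuller w w' : Cp_abs (w - w') < 1 -> teichmuller w = teichmuller w'.
Proof.
move=> ww'; rewrite /teichmuller; congr xget; apply/seteqP.
by split=> t [tw ts]; split=> //; apply: uabs_dist_lt tw _; rewrite // uabs_subC.
Qed.

Lemma eq_pole_value alpha w w' : Cp_abs (w - w') < 1 ->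
  pole_value alpha w = pole_value alpha w'.
Proof.
move=> ww'; rewrite /pole_value (eq_teichmuller ww'); congr (if _ then _ else _).
apply/idP/idP => h.
  by rewrite -(subKr w w'); apply: uabsB_le => //; apply: ltW.
by rewrite -(subrK w' w); apply: uabsD_le => //; apply: ltW.
Qed.

Let sub_1sub (x y : C) : 1 - x - (1 - y) = y - x.
Proof. by ring. Qed.

Let expr_1sub_near n w : Cp_abs w <= 1 ->
  Cp_abs ((1 - w) ^+ (p ^ n) - (1 - w ^+ (p ^ n))) < 1.
Proof.
move=> w1; apply: le_lt_trans vp1; rewrite -[X in _ - (X - _)](expr1n _ (p ^ n)).
by apply: exprB_pX => //; rewrite uabs1.
Qed.

Lemma uabs_1subX_eq1 (w : C) n : Cp_abs w <= 1 -> Cp_abs (1 - w) = 1 ->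
  Cp_abs (1 - w ^+ (p ^ n)) = 1.
Proof.
move=> w1 w'; rewrite (@uabs_near _ _ _ _ _ ((1 - w) ^+ (p ^ n))) uabsX w' expr1n //.
by rewrite uabs_subC expr_1sub_near.
Qed.

Lemma uabs_distV1 (x y : C) : Cp_abs x = 1 -> Cp_abs y = 1 ->
  Cp_abs (x^-1 - y^-1) = Cp_abs (x - y).
Proof.
move=> x1 y1; have x0 : x != 0 by rewrite -(uabs_gt0 (v := @Cp_abs _ _ C)) x1.
have y0 : y != 0 by rewrite -(uabs_gt0 (v := @Cp_abs _ _ C)) y1.
have -> : x^-1 - y^-1 = (y - x) / (x * y) by field; rewrite x0 y0.
by rewrite uabs_div uabsM x1 y1 mulr1 divr1 uabs_subC.
Qed.

(** With [q = p ^ alpha] and [t] the representative, [1 - t ^ q], [1 - w ^ q] and [(1 - w) ^ q] are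
    congruent units, and inversion preserves congruence of units. The last form is multiplicative in
    [1 - w], which is what exposes a Cauchy matrix. *)
Lemma pole_value_near alpha w : Cp_abs w <= 1 -> Cp_abs (1 - w) = 1 ->
  Cp_abs (pole_value alpha w - ((1 - w) ^+ (p ^ alpha))^-1) < 1.
Proof.
move=> w1 w'; have [tw _] := teichmullerP w1; rewrite /pole_value w1.
set t := teichmuller w in tw *.
have t1 : Cp_abs t <= 1 by rewrite -(subrK w t) uabsD_le // ltW.
have t' : Cp_abs (1 - t) = 1.
  by rewrite -w' (@uabs_near _ _ _ _ _ (1 - w)) // w' sub_1sub uabs_subC.
rewrite uabs_distV1 ?uabs_1subX_eq1 //; last by rewrite uabsX w' expr1n.
apply: (@uabs_dist_lt _ _ _ _ _ (1 - w ^+ (p ^ alpha))).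
  by rewrite sub_1sub uabs_subC; apply: le_lt_trans tw; apply: expr_pX_dist_le.
by rewrite uabs_subC expr_1sub_near.
Qed.

Lemma pole_limit_out alpha (w : C) s : 1 < Cp_abs w -> (0 < s)%N ->
  forall e : R, 0 < e -> exists K, forall k, (K <= k)%N ->
    Cp_abs (1 - w ^+ (p ^ (alpha + s * k)))^-1 < e.
Proof.
move=> w1 s0 e e0.
have wV : 0 <= (Cp_abs w)^-1 < 1 by rewrite invr_ge0 uabs_ge0 invf_lt1 // (lt_trans ltr01).
have [K HK] := expr_lt_eventually wV e0; exists K => k Kk.
set N := (p ^ _)%N; have Nk : (K <= N)%N.
  rewrite (leq_trans Kk) // (leq_trans _ (ltnW (ltn_expl _ (prime_gt1 p_prime)))) //.
  by rewrite (leq_trans _ (leq_addl _ _)) // leq_pmull.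
have N0 : (0 < N)%N by rewrite expn_gt0 prime_gt0.
rewrite uabsV uabs_dominant uabsN ?uabs1 uabsX ?exprn_egt1 -?lt0n //.
by rewrite -exprVn HK.
Qed.

(** The powers of [w'] approach those of the representative, which are constant along steps
    divisible by its period [s0]. Admitting all multiples of [s0] allows a common step for several
    classes; admitting all [w'] near [w] covers every pole of a hole at once. *)
Lemma pole_value_limit alpha (w : C) : Cp_abs w <= 1 -> exists2 s0, (0 < s0)%N &
  forall s w', (0 < s)%N -> (s0 %| s)%N -> Cp_abs (w' - w) < 1 -> Cp_abs (1 - w') = 1 ->
    forall e : R, 0 < e -> exists K, forall k, (K <= k)%N ->
      Cp_abs ((1 - w' ^+ (p ^ (alpha + s * k)))^-1 - pole_value alpha w) < e.
Proof.
move=> w1.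
have [tw [s0 s0_gt0 ts]] := teichmullerP w1; exists s0 => // s w' s_gt0 /dvdnP[c sE] w'w w'1 e e0.
rewrite /pole_value w1; set t := teichmuller w in tw ts *.
have w'le : Cp_abs w' <= 1 by rewrite -(subrK w w') uabsD_le // ltW.
have t1 : Cp_abs t <= 1 by rewrite -(subrK w t) uabsD_le // ltW.
have w't : Cp_abs (w' - t) < 1 by apply: uabs_dist_lt w'w _; rewrite uabs_subC.
have t' : Cp_abs (1 - t) = 1.
  by rewrite -w'1 (@uabs_near _ _ _ _ _ (1 - w')) // w'1 sub_1sub.
have iter n : t ^+ (p ^ (s0 * n)) = t.
  by elim: n => [|n IH]; rewrite ?muln0 ?expr1 // mulnS expnD exprM ts.
have [K HK] := expr_pX_dist_null p_prime vp1 w'le t1 w't e0.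
exists K => k Kk; have -> : t ^+ (p ^ alpha) = t ^+ (p ^ (alpha + s * k)).
  by rewrite sE addnC mulnAC mulnC expnD exprM iter.
rewrite uabs_distV1 ?uabs_1subX_eq1 // sub_1sub uabs_subC.
by apply: HK; rewrite (leq_trans Kk) // (leq_trans _ (leq_addl _ _)) // leq_pmull.
Qed.

End Teichmuller.

(** * Invertibility of perturbed Cauchy matrices *)

Lemma lagrange_interpolation (F : fieldType) (I : finType) (S : {set I}) (b : I -> F)
    (P : {poly F}) : {in S &, injective b} -> (size P <= #|S|)%N ->
  P = \sum_(i in S) P.[b i] *:
        \prod_(l in S :\ i) ((b i - b l)^-1 *: ('X - (b l)%:P)).
Proof.
move=> injb sP; apply/eqP; rewrite -subr_eq0; set Q := \sum_(i in S) _.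
have Qb i : i \in S -> Q.[b i] = P.[b i].
  move=> iS; rewrite horner_sum (bigD1 i) //= [X in _ + X]big1 ?addr0 => [|j /andP[jS ji]].
    rewrite hornerZ horner_prod big1 ?mulr1 // => l; rewrite !inE => /andP[li lS].
    rewrite hornerZ hornerXsubC mulVf // subr_eq0; apply: contraNneq li => bil.
    by apply/eqP/injb.
  rewrite hornerZ horner_prod (bigD1 i) /=; last by rewrite !inE eq_sym ji.
  by rewrite hornerZ hornerXsubC subrr mulr0 mul0r mulr0.
have sQ : (size Q <= #|S|)%N.
  apply: (leq_trans (size_sum _ _ _)); apply/bigmax_leqP => i iS.
  apply: (leq_trans (size_scale_leq _ _)).
  rewrite scaler_prod; apply: (leq_trans (size_scale_leq _ _)).
  by rewrite -big_enum size_prod_XsubC -cardE (cardsD1 i S) iS.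
apply/negPn/negP => PQ0.
have roots : all (root (P - Q)) [seq b i | i <- enum S].
  apply/allP => y /mapP[i]; rewrite mem_enum => iS ->.
  by rewrite rootE hornerD hornerN Qb // subrr.
have us : uniq [seq b i | i <- enum S].
  by rewrite map_inj_in_uniq ?enum_uniq // => i j; rewrite !mem_enum; apply: injb.
have := max_poly_roots PQ0 roots us; rewrite size_map -cardE ltnNge.
by rewrite (leq_trans (size_polyD _ _)) // size_polyN geq_max sP sQ.
Qed.

Section NearCauchy.
Variables (R : realType) (F : fieldType) (v : F -> R).
Context {vP : is_ultrametric_abs v}.
Variables (I : finType) (S : {set I}) (b x u : I -> F) (c : I -> I -> F).
Hypothesis bx1 : {in S &, forall i j, v (b i - x j) = 1}.
Hypothesis bb1 : {in S &, forall i j, i != j -> v (b i - b j) = 1}.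
Hypothesis xx1 : {in S &, forall i j, i != j -> v (x i - x j) = 1}.
Hypothesis c_near : {in S &, forall i j, v (c i j - (b i - x i) / (b i - x j)) < 1}.
Hypothesis cu0 : {in S, forall i, \sum_(j in S) c i j * u j = 0}.

(* Modulo the maximal ideal [c] is a rescaled Cauchy matrix; clearing the
   denominators of its row sums gives a polynomial of degree less than [#|S|]
   that is small at all the [b i], hence small everywhere on the unit disc. *)
Lemma near_cauchy_ker0 : {in S, forall j, u j = 0}.
Proof.
pose V := \big[Num.max/0]_(j in S) v (u j).
have uV j : j \in S -> v (u j) <= V by move=> jS; rewrite /V (bigD1 j) //= le_max lexx.
suff V0 : V <= 0.
  move=> j jS; apply/eqP; rewrite -(uabs_eq0 (v := v)) eq_le uabs_ge0 andbT.
  exact: le_trans (uV j jS) V0.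
rewrite leNgt; apply/negP => V0.
have neq0 y : v y = 1 -> y != 0 by move=> y1; rewrite -(uabs_gt0 (v := v)) y1.
have injb : {in S &, injective b}.
  move=> i j iS jS bij; apply/eqP/negPn/negP => ij.
  by have := bb1 iS jS ij; rewrite bij subrr uabs0 => /eqP; rewrite eq_sym oner_eq0.
pose g := \sum_(j in S) u j *: \prod_(l in S :\ j) ('X - (x l)%:P).
have sg : (size g <= #|S|)%N.
  apply: (leq_trans (size_sum _ _ _)); apply/bigmax_leqP => j jS.
  apply: (leq_trans (size_scale_leq _ _)).
  by rewrite -big_enum size_prod_XsubC -cardE (cardsD1 j S) jS.
have gb i : i \in S -> v g.[b i] < V.
  (* Because [c] annihilates [u], this is also the row sum of the exact Cauchy matrix, and it is
     smaller than [V]. *)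
  move=> iS; pose w := \sum_(j in S) ((b i - x i) / (b i - x j) - c i j) * u j.
  have wV : v w < V.
    apply: uabs_sum_lt => // j jS; rewrite uabsM uabs_subC.
    apply: le_lt_trans (_ : v (c i j - (b i - x i) / (b i - x j)) * V < V).
      by rewrite ler_wpM2l ?uabs_ge0 ?uV.
    by rewrite gtr_pMl ?c_near.
  have -> : g.[b i] = (\prod_(l in S) (b i - x l)) / (b i - x i) * w.
    have -> : w = \sum_(j in S) (b i - x i) / (b i - x j) * u j.
      rewrite /w; under eq_bigr => j _ do rewrite mulrBl.
      by rewrite sumrB cu0 // subr0.
    rewrite mulr_sumr horner_sum; apply: eq_bigr => j jS.
    rewrite hornerZ horner_prod (big_setD1 j jS) /=.
    under eq_bigr => l _ do rewrite hornerXsubC.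
    by field; rewrite !neq0 ?bx1.
  rewrite uabsM uabs_div uabs_prod bx1 // divr1 big1 ?mul1r // => l lS; exact: bx1.
have [j jS uj] : exists2 j, j \in S & v (u j) = V.
  have [/existsP[j /andP[jS /eqP uj]]|] := boolP [exists j, (j \in S) && (v (u j) == V)].
    by exists j.
  rewrite negb_exists => /forallP Pm; have : V < V; last by rewrite ltxx.
  rewrite {1}/V; apply: bigmax_lt => // j jS.
  by rewrite lt_neqAle uV // andbT; have := Pm j; rewrite jS.
have : v g.[x j] < V.
  rewrite (lagrange_interpolation injb sg) horner_sum; apply: uabs_sum_lt => // i iS.
  rewrite hornerZ horner_prod uabsM uabs_prod big1 ?mulr1 ?gb // => l.
  rewrite !inE => /andP[li lS]; rewrite hornerZ hornerXsubC uabsM uabsV bb1 // 1?eq_sym //.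
  by rewrite invr1 mul1r uabs_subC bx1.
(* At the node [x j] only the [j]-th term of [g] survives, with a unit factor, so
   [|g(x j)| = |u j| = V]: the contradiction. *)
rewrite horner_sum (bigD1 j) //= [X in _ + X]big1 ?addr0 => [|i /andP[iS ij]]; last first.
  rewrite hornerZ horner_prod (bigD1 j) /=; last by rewrite !inE eq_sym ij.
  by rewrite hornerXsubC subrr mul0r mulr0.
rewrite hornerZ horner_prod uabsM uabs_prod big1 ?mulr1 ?uj ?ltxx // => l.
by rewrite !inE => /andP[lj lS]; rewrite hornerXsubC xx1 // eq_sym.
Qed.

End NearCauchy.

(** * Systems of arcs *)

Lemma big_option (V : nmodType) (I : finType) (F : option I -> V) :
  \sum_o F o = F None + \sum_i F (Some i).
Proof.
rewrite (bigD1 None) //=; congr (_ + _).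
rewrite (reindex_omap Some id) /=; last by case.
by apply: eq_bigl => i; rewrite eqxx.
Qed.

Section Configuration.
Variables (p : nat) (R : realType) (C : Cp_model p R).
Hypothesis (p_prime : prime p) (p_odd : odd p).
Implicit Types (a b c d x : C) (r : R).

Let vp1 := Cp_abs_p_lt1 p_prime C.

(** Were [|2| < 1], then [1 = p - 2 (p - 1) / 2] would be small as well. *)
Lemma Cp_abs_2 : Cp_abs (2%:R : C) = 1.
Proof.
apply/eqP; rewrite eq_le uabs_nat_le1 leNgt; apply/negP => v2.
have p2 : p = (p./2 * 2).+1 by rewrite -[LHS]odd_double_half p_odd muln2.
have : Cp_abs (p%:R - p./2%:R * 2%:R : C) < 1.
  by rewrite uabsB_lt // uabsM (le_lt_trans _ v2) // ler_piMl ?uabs_ge0 ?uabs_nat_le1.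
have -> : p%:R = p./2%:R * 2%:R + 1 :> C by rewrite -natrM -[1]/(1%:R) -natrD addn1 -p2.
by rewrite addrC addKr uabs1 ltxx.
Qed.

(** The reflected point [2 c - b] also lies on the circle, at distance [|2| s = s] from [b], so the
    set determines its radius. A center at distance exactly [r] from the other would lie on the
    circle around itself. *)
Lemma eq_circle a a' b r r' : 0 < r -> circle a r b -> circle a r = circle a' r' ->
  r = r' /\ Cp_abs (a - a') < r.
Proof.
move=> r0 abr eqC; have ab'r : circle a' r' b by rewrite -eqC.
have half c c' s s' : circle c s b -> circle c s `<=` circle c' s' -> s <= s'.
  rewrite /circle /= => bs sub; pose y := 2%:R * c - b.
  have ys : Cp_abs (y - c) = s.
    by rewrite -bs uabs_subC; congr Cp_abs; rewrite /y; ring.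
  have -> : s = Cp_abs ((b - c') - (y - c')).
    have -> : b - c' - (y - c') = 2%:R * (b - c) by rewrite /y; ring.
    by rewrite uabsM Cp_abs_2 mul1r.
  by apply: uabsB_le; rewrite (sub _ _).
have rr' : r = r'.
  apply/eqP; rewrite eq_le (half a a' r r' abr) ?eqC // (half a' a r' r ab'r) // eqC.
  exact: subset_refl.
split=> //; rewrite -rr' in eqC ab'r.
rewrite lt_neqAle -{2}(subrK b a) -addrA uabsD_le ?(uabs_subC a b) ?abr ?ab'r ?andbT //.
apply/negP => /eqP aa'; have : circle a r a' by rewrite /circle /= uabs_subC.
by rewrite eqC /circle /= subrr uabs0 => r00; rewrite -r00 ltxx in r0.
Qed.

Lemma eq_disc_arc a b a' b' : a != b -> disc_arc a b = disc_arc a' b' ->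
  Cp_abs (b - b') < Cp_abs (a' - b').
Proof.
move=> ab eqA; have : disc_arc a b b.
  by rewrite /disc_arc /open_disc /= subrr uabs0 uabs_gt0 subr_eq0.
by rewrite eqA.
Qed.

(** The residue class of a coordinate survives perturbations of its three points by less than the
    radius. *)
Lemma ratio_near a b d a' b' d' r : 0 < r ->
  Cp_abs (b - a) = r -> Cp_abs (b' - a') = r -> Cp_abs (d' - a') <= r ->
  Cp_abs (a - a') < r -> Cp_abs (b - b') < r -> Cp_abs (d - d') < r ->
  Cp_abs ((d - a) / (b - a) - (d' - a') / (b' - a')) < 1.
Proof.
move=> r0 ba ba' da' aa' bb' dd'.
have t0 : b - a != 0 by rewrite -(uabs_gt0 (v := @Cp_abs _ _ C)) ba.
have t0' : b' - a' != 0 by rewrite -(uabs_gt0 (v := @Cp_abs _ _ C)) ba'.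
have -> : (d - a) / (b - a) - (d' - a') / (b' - a') =
    ((d - d') - (a - a')) / (b - a) +
    (d' - a') * ((a - a') - (b - b')) / ((b - a) * (b' - a')).
  by field; rewrite t0 t0'.
apply: uabsD_lt; rewrite uabs_div ?uabsM ?ba ?ba' ltr_pdivrMr ?mulr_gt0 // mul1r.
  exact: uabsB_lt.
apply: (@le_lt_trans _ _ (r * Cp_abs (a - a' - (b - b')))).
  by rewrite ler_wpM2r ?uabs_ge0.
by rewrite ltr_pM2l // uabsB_lt.
Qed.

Lemma teichmuller0 : teichmuller (0 : C) = 0.
Proof.
have v0 : Cp_abs (0 : C) <= 1 by rewrite uabs0.
apply: (teichmuller_unique p_prime v0 (teichmullerP p_prime p_odd v0)).
by split; [rewrite subrr uabs0|exists 1%N => //; rewrite expr0n gtn_eqF // expn_gt0 prime_gt0].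
Qed.

Lemma pole_value0 alpha : pole_value alpha (0 : C) = 1.
Proof.
rewrite /pole_value uabs0 ler01 teichmuller0 expr0n gtn_eqF ?expn_gt0 ?prime_gt0 //=.
by rewrite subr0 invr1.
Qed.

Variable (M : nat).
Implicit Types (y z : 'I_M -> C) (s : 'I_M -> R).

Record arc_system a b r y z s : Prop := ArcSystem {
  as_rad : 0 < r;
  as_ab : Cp_abs (b - a) = r;
  as_ya : forall i, Cp_abs (y i - a) <= r;
  as_s : forall i, 0 < s i /\ s i <= r;
  as_zy : forall i, Cp_abs (z i - y i) = s i;
  as_sep : forall i j, i != j -> s i <= Cp_abs (y i - y j) }.

(** The desired relation tested on a simple pole at the center of hole [j]. *)
Definition arc_weights alpha a b y z (mu : 'I_M -> C) : Prop := forall j,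
  pole_value alpha ((y j - a) / (b - a)) =
    \sum_i mu i * pole_value alpha ((y j - y i) / (z i - y i)).

(** Equal sets force equal radii, and centers and base points closer than the radius. Each
    coordinate then either keeps its residue class or stays outside the closed unit disc. *)
Lemma eq_arc_weights alpha mu a b r y z s a' b' r' y' z' s' :
  arc_system a b r y z s -> arc_system a' b' r' y' z' s' ->
  circle a r = circle a' r' -> disc_arc a b = disc_arc a' b' ->
  (fun j => circle (y j) (s j)) = (fun j => circle (y' j) (s' j)) ->
  (fun j => disc_arc (y j) (z j)) = (fun j => disc_arc (y' j) (z' j)) ->
  arc_weights alpha a b y z mu -> arc_weights alpha a' b' y' z' mu.
Proof.
move=> [r0 ab ya s0 zyi sep] [r0' ab' ya' s0' zy' sep'] eC eA eCs eAs.
have [rr' aa'] := eq_circle r0 ab eC.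
have bb' : Cp_abs (b - b') < r.
  rewrite rr' -ab' (uabs_subC b' a'); apply: eq_disc_arc eA.
  by rewrite -subr_eq0 -(uabs_gt0 (v := @Cp_abs _ _ C)) uabs_subC ab.
have ss' j : s j = s' j /\ Cp_abs (y j - y' j) < s j.
  by apply: eq_circle (s0 j).1 (zyi j) _; have := congr1 (fun f => f j) eCs.
have zz' j : Cp_abs (z j - z' j) < s j.
  rewrite (ss' j).1 -zy' (uabs_subC (z' j)).
  apply: eq_disc_arc; last exact: (congr1 (fun f => f j) eAs).
  by rewrite -subr_eq0 -(uabs_gt0 (v := @Cp_abs _ _ C)) uabs_subC zyi (s0 j).1.
have eq0 j : pole_value alpha ((y j - a) / (b - a)) = pole_value alpha ((y' j - a') / (b' - a')).
  apply: eq_pole_value; apply: (ratio_near r0) => //; rewrite ?rr' //.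
  by apply: lt_le_trans (ss' j).2 _; rewrite -rr' (s0 j).2.
have eq1 i j : pole_value alpha ((y j - y i) / (z i - y i)) =
    pole_value alpha ((y' j - y' i) / (z' i - y' i)).
  have [->|ij] := eqVneq i j; first by rewrite !subrr !mul0r.
  have dist : Cp_abs (y' j - y' i) = Cp_abs (y j - y i).
    apply: uabs_near.
    have -> : y' j - y' i - (y j - y i) = (y i - y' i) - (y j - y' j) by ring.
    apply: uabsB_lt; first by apply: lt_le_trans (ss' i).2 _; rewrite uabs_subC sep.
    by apply: lt_le_trans (ss' j).2 _; rewrite sep // eq_sym.
  (* In the second case both coordinates lie outside the closed unit disc and both pole values are
     0. *)
  have [le_i|lt_i] := leP (Cp_abs (y j - y i)) (s i).
    apply: eq_pole_value; apply: (ratio_near (s0 i).1) => //; rewrite ?dist //.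
    - by rewrite zy' (ss' i).1.
    - exact: (ss' i).2.
    - by apply: lt_le_trans (ss' j).2 _; apply: le_trans (sep j i _) _; rewrite // eq_sym.
  rewrite /pole_value !ifN //;
    rewrite uabs_div -ltNge ltr_pdivlMr ?mul1r ?zyi ?zy' ?(s0 i).1 ?(s0' i).1 //.
  by rewrite dist -(ss' i).1.
by move=> mu_w j; rewrite -eq0 mu_w; apply: eq_bigr => i _; rewrite eq1.
Qed.

(** A row with [s i < r] is a unit vector, since all other centers lie outside the closed disc of
    that arc. A kernel vector is thus supported on the indices with [s i = r], where the matrix is
    close to a Cauchy matrix. *)
Lemma arc_weights_exist alpha a b r y z s : arc_system a b r y z s ->
  (forall i j, i != j -> s i < r -> s i < Cp_abs (y i - y j)) ->
  (forall i j, s i = r -> s j = r -> Cp_abs (z i - y j) = r) ->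
  (forall i j, s i = r -> s j = r -> i != j -> Cp_abs (z i - z j) = r) ->
  exists mu : 'I_M -> C, arc_weights alpha a b y z mu.
Proof.
move=> [r0 ab ya s0 zyi sep] sep_lt zy zz.
pose c i j := pole_value alpha ((y j - y i) / (z i - y i)).
pose S : {set _} := [set i | s i == r]%SET; have inS i : (i \in S) = (s i == r) by rewrite /S inE.
have c_diag i : c i i = 1 by rewrite /c subrr mul0r pole_value0.
have c_out i j : i != j -> s i < r -> c i j = 0.
  move=> ij sir; rewrite /c /pole_value ifN // -ltNge uabs_div zyi.
  by rewrite ltr_pdivlMr ?(s0 i).1 // mul1r uabs_subC sep_lt.
pose A : 'M[C]_M := \matrix_(i, j) c i j.
have detA : \det A != 0.
  apply/negP => dA; have : \det A^T == 0 by rewrite det_tr.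
  case/det0P => u /negP u0 uA; apply: u0; apply/eqP/rowP => j; rewrite mxE.
  have cu i : \sum_j c i j * u 0 j = 0.
    have := congr1 (fun B : 'rV_M => B 0 i) uA; rewrite !mxE => e; rewrite -[RHS]e.
    by apply: eq_bigr => k _; rewrite !mxE mulrC.
  have uout i : i \notin S -> u 0 i = 0.
    rewrite inS => sir; have {}sir : s i < r by rewrite lt_neqAle sir (s0 i).2.
    rewrite -(cu i) (bigD1 i) //= c_diag mul1r big1 ?addr0 // => k ki.
    by rewrite c_out ?mul0r // eq_sym.
  have [jS|/uout//] := boolP (j \in S).
  (* The nodes of the Cauchy matrix are the [q]-th powers of the coordinates with respect to the
     outer arc. *)
  pose q := (p ^ alpha)%N; pose n d := (d - a) / (b - a).
  have nB d d' : n d - n d' = (d - d') / (b - a) by rewrite /n -mulrBl opprB addrA subrK.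
  have ndist d d' : Cp_abs (d - d') = r -> Cp_abs (n d - n d') = 1.
    by move=> dd'; rewrite nB uabs_div dd' ab divff // gt_eqF.
  have ny i : Cp_abs (n (y i)) <= 1 by rewrite uabs_div ab ler_pdivrMr // mul1r.
  have nz i : Cp_abs (n (z i)) <= 1.
    rewrite uabs_div ab ler_pdivrMr // mul1r -(subrK (y i) (z i)) -addrA.
    by rewrite uabsD_le // zyi (s0 i).2.
  have frob d d' : Cp_abs (n d) <= 1 -> Cp_abs (n d') <= 1 ->
      Cp_abs ((n d - n d') ^+ q - (n d ^+ q - n d' ^+ q)) < 1.
    by move=> d1 d1'; apply: le_lt_trans vp1; apply: exprB_pX.
  have frob1 d d' : Cp_abs (n d) <= 1 -> Cp_abs (n d') <= 1 -> Cp_abs (d - d') = r ->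
      Cp_abs (n d ^+ q - n d' ^+ q) = 1.
    move=> d1 d1' dd'; have e1 : Cp_abs ((n d - n d') ^+ q) = 1.
      by rewrite uabsX ndist // expr1n.
    by rewrite -e1; apply: uabs_near; rewrite e1 uabs_subC frob.
  have yy i k : i \in S -> i != k -> Cp_abs (y i - y k) = r.
    rewrite inS => /eqP si ik; apply/eqP; rewrite eq_le -{2}si sep // andbT.
    rewrite -[y i - y k](_ : (y i - a) - (y k - a) = _); last by ring.
    exact: uabsB_le.
  apply: (@near_cauchy_ker0 _ _ _ _ _ S (fun i => n (z i) ^+ q) (fun i => n (y i) ^+ q)
     (fun i => u 0 i) c) => //.
  - by move=> i k; rewrite !inS => /eqP si /eqP sk; apply: frob1; rewrite ?zy.
  - by move=> i k; rewrite !inS => /eqP si /eqP sk ik; apply: frob1; rewrite ?zz.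
  - by move=> i k iS _ ik; apply: frob1; rewrite ?yy.
  - move=> i k; rewrite !inS => /eqP si /eqP sk; rewrite /c.
    set w := (y k - y i) / (z i - y i).
    have zy0 i' : z i' - y i' != 0 by rewrite -(uabs_gt0 (v := @Cp_abs _ _ C)) zyi (s0 i').1.
    have ab0 : b - a != 0 by rewrite -(uabs_gt0 (v := @Cp_abs _ _ C)) ab.
    have w1 : Cp_abs w <= 1.
      rewrite uabs_div zyi ler_pdivrMr ?(s0 i).1 // mul1r.
      have [->|ik] := eqVneq i k; first by rewrite subrr uabs0 ltW ?(s0 k).1.
      by rewrite uabs_subC yy ?inS ?si.
    have w' : 1 - w = (n (z i) - n (y k)) / (n (z i) - n (y i)).
      by rewrite !nB /w; field; rewrite ab0 zy0.
    have zk1 := ndist _ _ (zy i k si sk); have zi1 := ndist _ _ (zy i i si si).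
    have w'1 : Cp_abs (1 - w) = 1 by rewrite w' uabs_div zk1 zi1 divr1.
    apply: uabs_dist_lt (pole_value_near p_prime p_odd alpha w1 w'1) _.
    (* The entry is close to a quotient of [q]-th powers of differences; additivity of Frobenius
       replaces these by the differences [B1], [B2] of [q]-th powers. *)
    rewrite w' -exprVn invf_div expr_div_n -/q.
    set A1 := n (z i) - n (y i); set A2 := n (z i) - n (y k).
    set B1 := _ ^+ q - n (y i) ^+ q; set B2 := _ ^+ q - n (y k) ^+ q.
    have B11 : Cp_abs B1 = 1 by apply: frob1; rewrite ?zy.
    have B21 : Cp_abs B2 = 1 by apply: frob1; rewrite ?zy.
    have A2q : Cp_abs (A2 ^+ q) = 1 by rewrite uabsX zk1 expr1n.
    have B20 : B2 != 0 by rewrite -(uabs_gt0 (v := @Cp_abs _ _ C)) B21.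
    have A20 : A2 ^+ q != 0 by rewrite -(uabs_gt0 (v := @Cp_abs _ _ C)) A2q.
    have -> : A1 ^+ q / A2 ^+ q - B1 / B2 =
        ((A1 ^+ q - B1) * B2 - B1 * (A2 ^+ q - B2)) / (A2 ^+ q * B2) by field; rewrite A20 B20.
    rewrite uabs_div uabsM A2q B21 mulr1 divr1.
    by apply: uabsB_lt; rewrite uabsM ?B21 ?B11 ?mulr1 ?mul1r frob.
  - move=> i iS; rewrite -[RHS](cu i) [RHS](bigID (mem S)) /= [X in _ = _ + X]big1 ?addr0 //.
    by move=> k /uout ->; rewrite mulr0.
pose w : 'rV[C]_M := \row_j pole_value alpha ((y j - a) / (b - a)).
exists (fun i => (w *m invmx A) 0 i) => j.
have uA : A \in unitmx by rewrite unitmxE unitfE.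
have := congr1 (fun B : 'rV_M => B 0 j) (mulmxKV uA w); rewrite !mxE => <-.
by apply: eq_bigr => i _; rewrite !mxE.
Qed.

End Configuration.

(** * The integral relation for given weights *)

Section Relation.
Variables (p : nat) (R : realType) (C : Cp_model p R) (M : nat).
Hypothesis (p_prime : prime p) (p_odd : odd p).
Variables (a b : C) (rad : R) (y z : 'I_M -> C) (rho s : 'I_M -> R).
Let D := closed_disc a rad `\` \bigcup_i open_disc (y i) (rho i).
Hypothesis sys : arc_system a b rad y z s.
Hypothesis by_rad : forall i, Cp_abs (b - y i) = rad.
Hypothesis rho_s : forall i, 0 < rho i /\ rho i <= s i.
Hypothesis rho_sep : forall i j, i != j -> rho j <= Cp_abs (y i - y j).
Hypothesis arcD : forall i, disc_arc (y i) (z i) `<=` D.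
Variables (alpha : nat) (mu : 'I_M -> C).
Hypothesis mu_w : arc_weights alpha a b y z mu.

(** The outer arc is indexed by [None] with weight 1 and the inner arcs by [Some i] with weight
    [- mu i], so that the relation says that a weighted sum vanishes. *)
Let ctr o := if o is Some i then y i else a.
Let pt o := if o is Some i then z i else b.
Let rd o := if o is Some i then s i else rad.
Let nu o := if o is Some i then - mu i else 1.

Let rd_gt0 o : 0 < rd o.
Proof. by case: o => [i|] /=; [case: (as_s sys i)|case: sys]. Qed.

Let rd_le o : rd o <= rad.
Proof. by case: o => [i|] //=; case: (as_s sys i). Qed.

Let abs_rd o : Cp_abs (pt o - ctr o) = rd o.
Proof. by case: o => [i|]; [apply: (as_zy sys)|apply: (as_ab sys)]. Qed.

Let arc_rd o x : disc_arc (ctr o) (pt o) x = (Cp_abs (x - pt o) < rd o).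
Proof. by rewrite /disc_arc /open_disc /= -(abs_rd o) uabs_subC (uabs_subC (pt o)). Qed.

Let ctr_pt o : ctr o != pt o.
Proof. by rewrite eq_sym -subr_eq0 -(uabs_gt0 (v := @Cp_abs _ _ C)) abs_rd. Qed.

Let arcsD o : disc_arc (ctr o) (pt o) `<=` D.
Proof.
case: o => [i|x]; first exact: arcD.
rewrite arc_rd => xb; split.
  rewrite /closed_disc /= -(subrK b x) -addrA.
  by apply: uabsD_le; rewrite ?(as_ab sys) // ltW.
move=> [i _]; rewrite /open_disc /= => xi.
have : Cp_abs (b - y i) < rad.
  apply: (@uabs_dist_lt _ _ _ _ _ x); first by rewrite uabs_subC.
  by rewrite (lt_le_trans xi) // (le_trans (rho_s i).2) // (as_s sys i).2.
by rewrite by_rad ltxx.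
Qed.

Let notD d : (~` D) d -> rad < Cp_abs (d - a) \/ exists i, Cp_abs (d - y i) < rho i.
Proof.
move=> nDd; have [da|] := leP (Cp_abs (d - a)) rad; last by left.
right; apply: contrapT => ni; apply: nDd; split=> // -[i _ di]; apply: ni; by exists i.
Qed.

(** Any point of an open ultrametric disc is a center of it, so a pole closer to [x] than the radius
    would lie in the arc and hence in [D]. *)
Let E_arc d o x : (~` D) d -> disc_arc (ctr o) (pt o) x ->
  Cp_abs (ctr o - pt o) <= Cp_abs (x - d).
Proof.
rewrite arc_rd (uabs_subC (ctr o)) abs_rd => nDd xo; rewrite leNgt; apply/negP => xd.
apply: nDd; apply: (@arcsD o); rewrite arc_rd.
by apply: uabs_dist_lt xo; rewrite uabs_subC.
Qed.

Let E_open d : (~` D) d ->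
  exists2 e : R, 0 < e & forall d', Cp_abs (d' - d) < e -> (~` D) d'.
Proof.
case/notD => [da|[i di]].
  have a0 : 0 < Cp_abs (d - a) by apply: lt_trans da; apply: (rd_gt0 None).
  exists (Cp_abs (d - a)) => // d' d'd [d'a _].
  have : Cp_abs (d' - a) = Cp_abs (d - a).
    by apply: uabs_near; rewrite opprB addrA subrK.
  by move: d'a; rewrite /closed_disc /= => /[swap] ->; rewrite leNgt da.
exists (rho i) => [|d' d'd [_ nd']]; first by case: (rho_s i).
by apply: nd'; exists i => //; rewrite /open_disc /=; apply: uabs_dist_lt d'd di.
Qed.

(** A pole in the closed disc of an arc but off the arc is at distance exactly [rd o] from the base
    point; its coordinate is therefore not congruent to 1. *)
Let dist_pole d o : (~` D) d -> Cp_abs (d - ctr o) <= rd o ->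
  Cp_abs (1 - (d - ctr o) / (pt o - ctr o)) = 1.
Proof.
move=> nDd le_d; have pc0 : pt o - ctr o != 0 by rewrite subr_eq0 eq_sym.
have -> : 1 - (d - ctr o) / (pt o - ctr o) = (pt o - d) / (pt o - ctr o).
  by field; rewrite pc0.
rewrite uabs_div abs_rd; have -> : Cp_abs (pt o - d) = rd o; last by rewrite divff // gt_eqF.
apply/eqP; rewrite eq_le; apply/andP; split.
  rewrite -[pt o - d](_ : (pt o - ctr o) - (d - ctr o) = _); last by ring.
  by rewrite uabsB_le ?abs_rd.
have := @E_arc d o (pt o) nDd; rewrite arc_rd subrr uabs0 rd_gt0 (uabs_subC (ctr o)) abs_rd.
exact.
Qed.

(** There are finitely many pairs of an arc and a hole; the product of their periods is a step that
    works for all of them. *)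
Let period : exists2 l, (0 < l)%N & forall o j, Cp_abs (y j - ctr o) <= rd o ->
  forall w', Cp_abs (w' - (y j - ctr o) / (pt o - ctr o)) < 1 -> Cp_abs (1 - w') = 1 ->
    forall e : R, 0 < e -> exists K, forall k, (K <= k)%N ->
      Cp_abs ((1 - w' ^+ (p ^ (alpha + l * k)))^-1 -
        pole_value alpha ((y j - ctr o) / (pt o - ctr o))) < e.
Proof.
have /choice[l lP] : forall oj : option 'I_M * 'I_M, exists l, (0 < l)%N /\
   (Cp_abs (y oj.2 - ctr oj.1) <= rd oj.1 ->
   forall s w', (0 < s)%N -> (l %| s)%N ->
     Cp_abs (w' - (y oj.2 - ctr oj.1) / (pt oj.1 - ctr oj.1)) < 1 -> Cp_abs (1 - w') = 1 ->
    forall e : R, 0 < e -> exists K, forall k, (K <= k)%N ->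
      Cp_abs ((1 - w' ^+ (p ^ (alpha + s * k)))^-1 -
        pole_value alpha ((y oj.2 - ctr oj.1) / (pt oj.1 - ctr oj.1))) < e).
  move=> [o j] /=; have [le_o|] := boolP (Cp_abs (y j - ctr o) <= rd o); last by exists 1%N.
  have [|l l0 lP] := @pole_value_limit p R C p_prime p_odd alpha ((y j - ctr o) / (pt o - ctr o)).
    by rewrite uabs_div abs_rd ler_pdivrMr // mul1r.
  by exists l; split.
have l0 : (0 < \prod_oj l oj)%N by rewrite prodn_gt0 // => oj; case: (lP oj).
exists (\prod_oj l oj)%N => // o j le_o w' ww' w'1 e e0.
have [_ /(_ le_o)] := lP (o, j); apply => //.
by rewrite (bigD1 (o, j)) //= dvdn_mulr.
Qed.

Let pole_avgE d o n : (~` D) d ->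
  arc_avg (ctr o) (pt o) (fun x => (x - d)^-1) (p ^ n) =
    (1 - ((d - ctr o) / (pt o - ctr o)) ^+ (p ^ n))^-1.
Proof.
move=> nDd; rewrite arc_avg_pole // ?expn_gt0 ?prime_gt0 //.
have [le_d|lt_d] := leP (Cp_abs (d - ctr o)) (rd o).
  apply: contraTneq isT => wn; have := dist_pole nDd le_d.
  move/(uabs_1subX_eq1 p_prime p_odd n); rewrite wn subrr uabs0 uabs_div abs_rd.
  by rewrite ler_pdivrMr // mul1r => /(_ le_d)/eqP; rewrite eq_sym oner_eq0.
apply: contraTneq isT => /(congr1 (@Cp_abs _ _ C)); rewrite uabs1 uabsX uabs_div abs_rd => w1.
have : 1 < (Cp_abs (d - ctr o) / rd o) ^+ (p ^ n).
  by rewrite exprn_egt1 ?ltr_pdivlMr ?mul1r // -lt0n expn_gt0 prime_gt0.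
by rewrite w1 ltxx.
Qed.

Lemma arc_integral_relation : exists2 l, (0 < l)%N &
  forall f, krasner_analytic D f -> averages_settle ctr pt nu (fun k => alpha + l * k)%N f.
Proof.
have [l l0 lP] := period; exists l => // f fD.
have phi_ge k : (k <= alpha + l * k)%N.
  by rewrite (leq_trans _ (leq_addl _ _)) // leq_pmull.
apply: (averages_settle_krasner p_prime p_odd ctr_pt phi_ge E_arc E_open _ erefl arcsD fD).
move=> d nDd; apply/averages_settleP; case: (notD nDd) => [da|[j dj]].
  (* A pole beyond the outer circle is at distance [|d - a| > rad] from every center, so each
     average tends to 0. *)
  exists (fun=> 0) => [o e e0|]; last by rewrite big1 // => o _; rewrite mulr0.
  have w1 : 1 < Cp_abs ((d - ctr o) / (pt o - ctr o)).
    rewrite uabs_div abs_rd ltr_pdivlMr // mul1r (le_lt_trans (rd_le o)) //.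
    have -> : Cp_abs (d - ctr o) = Cp_abs (d - a); last by [].
    apply: uabs_near; rewrite (_ : _ - _ = a - ctr o); last by ring.
    rewrite uabs_subC; apply: le_lt_trans da; case: o => [i|] /=; first exact: (as_ya sys).
    by rewrite subrr uabs0 ltW // (rd_gt0 None).
  have [K HK] := pole_limit_out p_prime alpha w1 l0 e0.
  by exists K => k Kk; rewrite pole_avgE // subr0 HK.
(* The limits depend on [d] only through its hole [j], and their weighted sum vanishes by the [j]-th
   equation for [mu]. *)
exists (fun o => pole_value alpha ((y j - ctr o) / (pt o - ctr o))); last first.
  rewrite big_option mul1r mu_w -big_split big1 //= => i _.
  by rewrite mulNr addrN.
move=> o e e0; have [le_o|lt_o] := leP (Cp_abs (y j - ctr o)) (rd o).
  have rho_o : rho j <= rd o.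
    case: o le_o => [i|] /= le_o; last by apply: le_trans (rho_s j).2 (as_s sys j).2.
    have [ij|ij] := eqVneq i j; first by rewrite ij (rho_s j).2.
    by apply: le_trans le_o; rewrite uabs_subC rho_sep.
  have le_d : Cp_abs (d - ctr o) <= rd o.
    by rewrite -(subrK (y j) d) -addrA uabsD_le // ltW // (lt_le_trans dj).
  have [||K HK] := lP o j le_o ((d - ctr o) / (pt o - ctr o)) _ _ e e0.
  - rewrite -mulrBl opprB addrA subrK uabs_div abs_rd ltr_pdivrMr // mul1r.
    exact: lt_le_trans dj rho_o.
  - exact: dist_pole.
  by exists K => k Kk; rewrite pole_avgE // HK.
(* The center of hole [j] lies outside the closed disc of the arc, which must be an inner one; limit
   and pole value are both 0. *)
case: o lt_o => [i|] lt_o; last by have := lt_le_trans lt_o (as_ya sys j); rewrite ltxx.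
have ij : i != j by apply: contraTneq lt_o => ->; rewrite subrr uabs0 -leNgt ltW.
have di : Cp_abs (d - y i) = Cp_abs (y j - y i).
  by apply: uabs_near; rewrite opprB addrA subrK (lt_le_trans dj) // uabs_subC rho_sep.
have w1 : 1 < Cp_abs ((d - y i) / (z i - y i)).
  by rewrite uabs_div (abs_rd (Some i)) ltr_pdivlMr // mul1r di.
have [K HK] := pole_limit_out p_prime alpha w1 l0 e0.
exists K => k Kk; rewrite pole_avgE // /pole_value ifN ?subr0 ?HK //.
by rewrite -ltNge uabs_div (abs_rd (Some i)) ltr_pdivlMr // mul1r.
Qed.

End Relation.

(** * Choice of the constants and conclusion *)

Theorem theorem6p6 (p : nat) (p_prime : prime p) (p_odd : odd p)
    (R : realType) (C : Cp_model p R) (M : nat) :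
  exists mu : nat -> set C -> set C -> set C -> ('I_M -> set C) -> ('I_M -> set C) ->
              'I_M -> C,
  forall (alpha m : nat) (a b : C) (rad : R)
         (x b_ : 'I_M -> C) (rho r : 'I_M -> R),
  let D := closed_disc a rad `\` \bigcup_i open_disc (x i) (rho i) in
  (m <= M)%N ->
  0 < rad ->
  (forall i, 0 < rho i) ->
  (forall i : 'I_M, (i < m)%N -> rho i = rad) ->
  (forall i : 'I_M, (m <= i)%N -> rho i < rad) ->
  (forall i : 'I_M, (i < m)%N -> Cp_abs (a - x i) = rad) ->
  trivIset setT (fun i => open_disc (x i) (rho i)) ->
  circle a rad b ->
  (forall i, Cp_abs (b - x i) = rad) ->
  (forall i, rho i <= r i /\ r i <= rad) ->
  trivIset [set i : 'I_M | (m <= i)%N] (fun i => closed_disc (x i) (r i)) ->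
  (forall i, circle (x i) (r i) (b_ i)) ->
  (forall i : 'I_M, (i < m)%N -> forall j, Cp_abs (b_ i - x j) = rad) ->
  (forall i : 'I_M, (i < m)%N -> forall j, i != j -> Cp_abs (b_ i - b_ j) = rad) ->
  (forall i, disc_arc (x i) (b_ i) `<=` D) ->
  forall f : C -> C, krasner_analytic D f ->
  exists (L : C) (L_ : 'I_M -> C),
    [/\ is_arc_integral a b (Phi_ alpha%:Z) f L,
        forall i, is_arc_integral (x i) (b_ i) (Phi_ alpha%:Z) f (L_ i)
      & L = \sum_(i < M)
              mu alpha D (circle a rad) (disc_arc a b)
                 (fun j => circle (x j) (r j)) (fun j => disc_arc (x j) (b_ j)) i * L_ i].
Proof.
(* The weights must be a function of the circles and arcs as sets, not of their
   centers and base points; [eq_arc_weights] makes this choice meaningful. *)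
exists (fun alpha D Ci Ar Cis Ars i => (xget [ffun=> 0]
  [set mu : {ffun 'I_M -> C} | forall a b rad (y z : 'I_M -> C) (s : 'I_M -> R),
    arc_system a b rad y z s -> Ci = circle a rad -> Ar = disc_arc a b ->
    Cis = (fun j => circle (y j) (s j)) -> Ars = (fun j => disc_arc (y j) (z j)) ->
    arc_weights alpha a b y z mu] : {ffun 'I_M -> C}) i).
move=> alpha m a b rad x b_ rho r D mM rad0 rho0 rho_lo rho_hi ax disj ab bx rho_r disjc
  xb_ b_x b_b_ arcD f fD.
have sub_sep (S : set 'I_M) (F : 'I_M -> set C) : trivIset S F ->
    forall i j, S i -> S j -> i != j -> F j (x j) -> ~ F i (x j).
  move=> tF i j Si Sj ij Fj Fi; move/eqP: ij; apply; apply: tF => //.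
  by exists (x j).
have xx i j : i != j -> rho i <= Cp_abs (x i - x j).
  move=> ij; rewrite leNgt; apply/negP => xij; apply: (sub_sep _ _ disj i j) => //.
    by rewrite /open_disc /= subrr uabs0.
  by rewrite /open_disc /= uabs_subC.
have xa i : Cp_abs (x i - a) <= rad.
  rewrite -(subrK b (x i)) -addrA uabsD_le // ?(uabs_subC (x i)) ?bx //.
  by rewrite ab.
have xxr i j : Cp_abs (x i - x j) <= rad.
  rewrite -[x i - x j](_ : (x i - a) - (x j - a) = _); last by ring.
  exact: uabsB_le.
have xx_lo (i j : 'I_M) : (i < m)%N || (j < m)%N -> i != j -> Cp_abs (x i - x j) = rad.
  move=> /orP[im|jm] ij; apply/eqP; rewrite eq_le xxr /=.
    by rewrite -(rho_lo i im) xx.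
  by rewrite -(rho_lo j jm) uabs_subC xx // eq_sym.
have xx_hi (i j : 'I_M) : (m <= i)%N -> (m <= j)%N -> i != j -> r i < Cp_abs (x i - x j).
  move=> mi mj ij; rewrite ltNge; apply/negP => xij.
  apply: (sub_sep _ _ disjc i j) => //; last by rewrite /closed_disc /= uabs_subC.
  by rewrite /closed_disc /= subrr uabs0 (le_trans (ltW (rho0 j))) // (rho_r j).1.
have sys : arc_system a b rad x b_ r.
  split=> // [i|i j ij]; first by rewrite (lt_le_trans (rho0 i) (rho_r i).1) (rho_r i).2.
  have [lo|] := boolP ((i < m)%N || (j < m)%N); first by rewrite xx_lo // (rho_r i).2.
  by rewrite negb_or -!leqNgt => /andP[mi mj]; rewrite ltW // xx_hi.
have [mu0 mu0_w] : exists mu0 : 'I_M -> C, arc_weights alpha a b x b_ mu0.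
  apply: (arc_weights_exist p_prime p_odd alpha sys).
  - move=> i j ij ri; have [lo|] := boolP ((i < m)%N || (j < m)%N); first by rewrite xx_lo.
    by rewrite negb_or -!leqNgt => /andP[mi mj]; rewrite xx_hi.
  - move=> i j ri rj; have [im|mi] := ltnP i m; first exact: b_x.
    have [->|ij] := eqVneq i j; first by rewrite -rj; apply: xb_.
    (* Two different indices [>= m] are impossible: all centers are within [rad] of each other, and
       the closed disc [i] has radius [rad]. *)
    have [jm|mj] := ltnP j m; last by have := xx_hi _ _ mi mj ij; rewrite ri ltNge xxr.
    apply/eqP; rewrite eq_le; apply/andP; split.
      rewrite -(subrK (x i) (b_ i)) -addrA uabsD_le //.
      by have := xb_ i; rewrite /circle /= => ->; rewrite ri.
    (* [b_ i] lies on its own arc, hence in [D], and so not in the removed disc [j], whose radius is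
       [rad]. *)
    rewrite leNgt; apply/negP => bij; have [_] : D (b_ i).
      apply: (arcD i); rewrite /disc_arc /open_disc /= subrr uabs0 uabs_subC (xb_ i).
      by rewrite (lt_le_trans (rho0 i) (rho_r i).1).
    by apply; exists j => //; rewrite /open_disc /= rho_lo.
  - move=> i j ri rj ij; have [im|mi] := ltnP i m; first exact: b_b_.
    have [jm|mj] := ltnP j m; first by rewrite uabs_subC b_b_ // eq_sym.
    by have := xx_hi _ _ mi mj ij; rewrite ri ltNge xxr.
set mus := [set mu : {ffun 'I_M -> C} | _].
have [mu mu_w] : exists mu, mus mu.
  (* Weights found for the given centers and base points solve the system of every other description
     of the same sets. *)
  exists [ffun i => mu0 i] => a' b' rad' y z s sys' eC eA eCs eAs.
  apply: (eq_arc_weights p_prime p_odd sys sys' eC eA eCs eAs) => j.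
  by rewrite mu0_w; apply: eq_bigr => i _; rewrite ffunE.
have {mu mu_w} mu_w := xgetPex [ffun=> 0] (ex_intro _ mu mu_w).
have {}mu_w := mu_w _ _ _ _ _ _ sys erefl erefl erefl erefl.
set mu := xget _ _ in mu_w *.
have rho_sep i j : i != j -> rho j <= Cp_abs (x i - x j).
  by move=> ij; rewrite uabs_subC xx // eq_sym.
have rho_r' i : 0 < rho i /\ rho i <= r i by split => //; case: (rho_r i).
have [l l0 /(_ f fD) /averages_settleP[L fL Lsum]] :=
  arc_integral_relation p_prime p_odd sys bx rho_r' rho_sep arcD mu_w.
have integral o : is_arc_integral (if o is Some i then x i else a)
    (if o is Some i then b_ i else b) (Phi_ alpha%:Z) f (L o).
  move=> e e0; have [K HK] := fL o e e0.
  (* One path sequence, of step [l], serves all arcs and all accuracies. *)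
  exists (affine_path_seq alpha%:Z l0); first exact: Phi_affine.
  exists K => k _ Kk; rewrite arc_averageE /=.
  exact: (HK k (ltnW Kk)).
exists (L None), (fun i => L (Some i)); split.
- exact: (integral None).
- by move=> i; exact: (integral (Some i)).
move: Lsum; rewrite big_option mul1r => /eqP; rewrite addr_eq0 => /eqP ->.
by rewrite -sumrN; apply: eq_bigr => i _; rewrite mulNr opprK.
Qed.
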